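(* Let $\lambda$ be a CPM (computable, proper, mixable) loss function. Let $F$ be a prediction algorithm and let $\zeta\in\mathbf{Z}^{\infty}$ be an infinite data sequence. If $\zeta$ is random with respect to $F$ under the log loss function, then $\zeta$ is random with respect to $F$ under $\lambda$.
   Context: Binary probabilistic prediction: a loss function is a pair $\lambda=(\lambda_0,\lambda_1)$ of functions $[0,1]\to\mathbb{R}\cup\{+\infty\}$, with $\lambda(p,y):=\lambda_y(p)$ the loss of predicting $p\in[0,1]$ (the predicted probability that the label is $1$) when the label is $y\in\{0,1\}$. It is assumed that $\lambda_0(0)=\lambda_1(1)=0$, $\lambda_0$ is increasing, $\lambda_1$ is decreasing, and $\lambda_y(p)<\infty$ unless $p\in\{0,1\}$. The loss function $\lambda$ is $\eta$-mixable ($\eta\in(0,\infty)$) if the set $\{(u,v)\in[0,1]^2 : \exists p\in[0,1],\ u\le e^{-\eta\lambda(p,0)},\ v\le e^{-\eta\lambda(p,1)}\}$ is convex, and mixable if it is $\eta$-mixable for some $\eta$. It is proper if $p\lambda(p,1)+(1-p)\lambda(p,0)\le p\lambda(q,1)+(1-p)\lambda(q,0)$ for all $p,q\in[0,1]$. A CPM loss function is one that is computable, proper and mixable. The log loss function is $\lambda_1(p)=-\ln p$, $\lambda_0(p)=-\ln(1-p)$. Data: $\mathbf{X}$ is a finite set of objects, $\mathbf{Z}=\mathbf{X}\times\{0,1\}$, $\mathbf{Z}^*$ the finite sequences over $\mathbf{Z}$ (with $\Box$ the empty sequence). A prediction algorithm is a computable function $F:\mathbf{Z}^*\times\mathbf{X}\to[0,1]$.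 For $\sigma=(z_1,\dots,z_T)$, $z_t=(x_t,y_t)$, the cumulative loss is $\mathrm{Loss}^{\lambda}_F(\sigma)=\sum_{t=1}^T\lambda(F(z_1,\dots,z_{t-1},x_t),y_t)$ (with $\infty+a=\infty$). A function $L:\mathbf{Z}^*\to\mathbb{R}\cup\{\infty\}$ is a superloss process under $\lambda$ if for all $\sigma\in\mathbf{Z}^*$ and $x\in\mathbf{X}$ there is $p\in[0,1]$ such that $L(\sigma,(x,y))\ge L(\sigma)+\lambda(p,y)$ for both $y\in\{0,1\}$. For computable mixable $\lambda$ there exists an upper semicomputable superloss process $\mathrm{K}^{\lambda}$ that is smallest up to an additive constant among upper semicomputable superloss processes (i.e. for every such $L$ there is $c$ with $\mathrm{K}^{\lambda}\le L+c$); one such is fixed and called the predictive complexity under $\lambda$. The randomness deficiency is $D^{\lambda}_F(\sigma)=\mathrm{Loss}^{\lambda}_F(\sigma)-\mathrm{K}^{\lambda}(\sigma)$. For $\zeta=(z_1,z_2,\dots)\in\mathbf{Z}^{\infty}$, $\zeta^T=(z_1,\dots,z_T)$, and $\zeta$ is random with respect to $F$ under $\lambda$ if $\sup_T D^{\lambda}_F(\zeta^T)<\infty$. *)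

(* Defs.v *)
From Stdlib Require Import Reals QArith List Arith ZArith.
From Coquelicot Require Import Rbar.
Import ListNotations.
Open Scope R_scope.

Inductive code : Type :=
  | CZero : code
  | CSucc : code
  | CProj : nat -> code
  | COracle : code
  | CComp : code -> list code -> code
  | CPrec : code -> code -> code
  | CMin  : code -> code.

Inductive eval (g : nat -> nat) : code -> list nat -> nat -> Prop :=
  | ev_zero xs : eval g CZero xs 0
  | ev_succ x xs : eval g CSucc (x :: xs) (S x)
  | ev_proj i xs : eval g (CProj i) xs (nth i xs 0%nat)
  | ev_oracle x xs : eval g COracle (x :: xs) (g x)
  | ev_comp f gs xs ys v :
      evals g gs xs ys -> eval g f ys v -> eval g (CComp f gs) xs v
  | ev_prec0 f h xs v : eval g f xs v -> eval g (CPrec f h) (0%nat :: xs) v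
  | ev_precS f h n xs r v :
      eval g (CPrec f h) (n :: xs) r -> eval g h (n :: r :: xs) v ->
      eval g (CPrec f h) (S n :: xs) v
  | ev_min f xs n :
      eval g f (n :: xs) 0%nat ->
      (forall m, (m < n)%nat -> exists w, eval g f (m :: xs) (S w)) ->
      eval g (CMin f) xs n
with evals (g : nat -> nat) : list code -> list nat -> list nat -> Prop :=
  | evs_nil xs : evals g [] xs []
  | evs_cons c cs xs v vs :
      eval g c xs v -> evals g cs xs vs -> evals g (c :: cs) xs (v :: vs).

Definition no_oracle : nat -> nat := fun _ => 0%nat.

(* Cantor pairing and its inverse (a bijection nat <-> nat * nat) *)
Definition pairN (a b : nat) : nat := ((a + b) * (a + b + 1) / 2 + b)%nat.

Fixpoint unpairN (m : nat) : nat * nat :=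
  match m with
  | O => (0%nat, 0%nat)
  | S m' => let (a, b) := unpairN m' in
            match a with O => (S b, 0%nat) | S a' => (a', S b) end
  end.

Definition zdec (n : nat) : Z :=
  if Nat.even n then Z.of_nat (Nat.div2 n) else (- Z.of_nat (Nat.div2 (S n)))%Z.

(* nat -> Q surjection used to read rational outputs of programs *)
Definition decQ (m : nat) : Q :=
  let (a, b) := unpairN m in Qmake (zdec a) (Pos.of_succ_nat b).

Definition qR (m : nat) : R := Q2R (decQ m).

(* The finite set of objects X, identified with {0, ..., k-1}. *)
Definition Obj (k : nat) : Type := {i : nat | (i < k)%nat}.
Definition Zt (k : nat) : Type := (Obj k * bool)%type.

Definition encZ {k} (z : Zt k) : nat := pairN (proj1_sig (fst z)) (Nat.b2n (snd z)).
Fixpoint encS {k} (s : list (Zt k)) : nat :=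
  match s with [] => 0%nat | z :: s' => S (pairN (encZ z) (encS s')) end.

Definition name_of (g : nat -> nat) (p : R) : Prop :=
  forall n, Rabs (qR (g n) - p) <= / 2 ^ n.

(* Homeomorphism of the extended real line [-oo,+oo] onto [-1,1]. *)
Definition squash (x : Rbar) : R :=
  match x with
  | Finite r => r / (1 + Rabs r)
  | p_infty => 1
  | m_infty => -1
  end.

(* lambda is computable: both lambda_0, lambda_1 : [0,1] -> [-oo,+oo] are
   (type-2) computable, extended reals being represented through [squash]. *)
Definition computable_loss (lam : bool -> R -> Rbar) : Prop :=
  exists e : code, forall (y : bool) (p : R), 0 <= p <= 1 ->
    forall g, name_of g p -> forall n, exists m,
      eval g e [n; Nat.b2n y] m /\ Rabs (qR m - squash (lam y p)) <= / 2 ^ n.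

Definition prediction_algorithm {k} (F : list (Zt k) -> Obj k -> R) : Prop :=
  (forall s x, 0 <= F s x <= 1) /\
  exists e : code, forall s x n, exists m,
    eval no_oracle e [n; encS s; proj1_sig x] m /\ Rabs (qR m - F s x) <= / 2 ^ n.

Definition upper_semicomputable {k} (L : list (Zt k) -> Rbar) : Prop :=
  exists e : code, forall s m,
    (exists v, eval no_oracle e [m; encS s] v) <-> Rbar_lt (L s) (Finite (qR m)).

Definition loss_function (lam : bool -> R -> Rbar) : Prop :=
  (forall y p, lam y p <> m_infty) /\
  lam false 0 = Finite 0 /\ lam true 1 = Finite 0 /\
  (forall p q, 0 <= p -> p <= q -> q <= 1 -> Rbar_le (lam false p) (lam false q)) /\
  (forall p q, 0 <= p -> p <= q -> q <= 1 -> Rbar_le (lam true q) (lam true p)) /\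
  (forall y p, 0 < p < 1 -> is_finite (lam y p)).

Definition expneg (eta : R) (x : Rbar) : R :=
  match x with
  | Finite r => exp (- (eta * r))
  | p_infty => 0
  | m_infty => 1
  end.

Definition superpred_set (lam : bool -> R -> Rbar) (eta : R) (u v : R) : Prop :=
  0 <= u <= 1 /\ 0 <= v <= 1 /\
  exists p, 0 <= p <= 1 /\ u <= expneg eta (lam false p) /\ v <= expneg eta (lam true p).

Definition eta_mixable (lam : bool -> R -> Rbar) (eta : R) : Prop :=
  forall u1 v1 u2 v2 t,
    superpred_set lam eta u1 v1 -> superpred_set lam eta u2 v2 -> 0 <= t <= 1 ->
    superpred_set lam eta (t * u1 + (1 - t) * u2) (t * v1 + (1 - t) * v2).

Definition mixable (lam : bool -> R -> Rbar) : Prop :=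
  exists eta, 0 < eta /\ eta_mixable lam eta.

(* a * x for a >= 0, with the convention 0 * (+oo) = 0 *)
Definition smul (a : R) (x : Rbar) : Rbar :=
  match x with
  | Finite r => Finite (a * r)
  | p_infty => if Req_EM_T a 0 then Finite 0 else p_infty
  | m_infty => if Req_EM_T a 0 then Finite 0 else m_infty
  end.

Definition expected_loss (lam : bool -> R -> Rbar) (p q : R) : Rbar :=
  Rbar_plus (smul p (lam true q)) (smul (1 - p) (lam false q)).

Definition proper (lam : bool -> R -> Rbar) : Prop :=
  forall p q, 0 <= p <= 1 -> 0 <= q <= 1 ->
    Rbar_le (expected_loss lam p p) (expected_loss lam p q).

Definition CPM (lam : bool -> R -> Rbar) : Prop :=
  loss_function lam /\ computable_loss lam /\ proper lam /\ mixable lam.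

Definition log_loss (y : bool) (p : R) : Rbar :=
  if y then (if Rlt_dec 0 p then Finite (- ln p) else p_infty)
  else (if Rlt_dec p 1 then Finite (- ln (1 - p)) else p_infty).

Fixpoint loss_aux {k} (lam : bool -> R -> Rbar) (F : list (Zt k) -> Obj k -> R)
    (past rest : list (Zt k)) : Rbar :=
  match rest with
  | [] => Finite 0
  | (x, y) :: r => Rbar_plus (lam y (F past x)) (loss_aux lam F (past ++ [(x, y)]) r)
  end.

Definition Loss {k} (lam : bool -> R -> Rbar) (F : list (Zt k) -> Obj k -> R)
    (s : list (Zt k)) : Rbar := loss_aux lam F [] s.

Definition superloss_process {k} (lam : bool -> R -> Rbar) (L : list (Zt k) -> Rbar) : Prop :=
  (forall s, L s <> m_infty) /\
  forall (s : list (Zt k)) (x : Obj k), exists p, 0 <= p <= 1 /\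
    forall y : bool, Rbar_le (Rbar_plus (L s) (lam y p)) (L (s ++ [(x, y)])).

Definition predictive_complexity {k} (lam : bool -> R -> Rbar) (K : list (Zt k) -> Rbar) : Prop :=
  superloss_process lam K /\ upper_semicomputable K /\
  forall L : list (Zt k) -> Rbar, superloss_process lam L -> upper_semicomputable L ->
    exists c : R, forall s, Rbar_le (K s) (Rbar_plus (L s) (Finite c)).

Definition deficiency {k} (lam : bool -> R -> Rbar) (K : list (Zt k) -> Rbar)
    (F : list (Zt k) -> Obj k -> R) (s : list (Zt k)) : Rbar :=
  Rbar_minus (Loss lam F s) (K s).

Definition prefix {k} (zeta : nat -> Zt k) (T : nat) : list (Zt k) :=
  map zeta (seq 0 T).

Definition random_wrt {k} (lam : bool -> R -> Rbar) (K : list (Zt k) -> Rbar)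
    (F : list (Zt k) -> Obj k -> R) (zeta : nat -> Zt k) : Prop :=
  exists C : R, forall T, Rbar_le (deficiency lam K F (prefix zeta T)) (Finite C).

(* Main.v *)
(** The process [(Klam + M Loss_log - Loss_lam) / M] is a superloss process under the
    log loss once [1 / M] is at most the mixability constant: by properness, the curve
    [(exp (- eta lam_0 q), exp (- eta lam_1 q))] has at [q = F] the supporting line
    [(1 - F) u / u_F + F v / v_F = 1], so tilting [F] by [exp ((lam F y - lam p y) / M)]
    yields total mass at most one. Hence [Klog] is below it up to a constant, which bounds
    the deficiency under [lam] by [M] times the one under the log loss.
    For upper semicomputability, [M Loss_log - Loss_lam] is replaced by a sum [B] of
    rational increments that are exact up to [(M + 1) 2^-t] from above at step [t]; each is
    found by unbounded search for a certificate, which succeeds exactly when the observed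
    label has positive probability under [F]. Then [(Klam + B) / M < q] is just
    [Klam < M q - B], and the program of [Klam] is run on one computed rational. *)

(* The program that semicomputes [Klam] reveals only whether it halts, so it is used as a black box.
   Against a real-valued correction, a bound could only be found by trying many rational splittings
   in parallel, that is by a dovetailed simulation of codes; against an exactly computed rational,
   one query is enough. This forces the rounding. It goes upward because the superloss inequality
   tolerates only larger increments. Errors of order 2^-t add up to at most 2 (M + 1), whatever the
   length of the data. M is an integer so that scaling by it stays rational; the passage from eta to
   the smaller exponent 1 / M is convexity of exp. Infinite values are the other obstacle. In [Rbar]
   the difference of two equal infinities is 0, so a bounded deficiency alone does not make the log
   loss of F finite: finiteness of [Klog] is proved separately, by comparison with the constant
   prediction 1/2. Once all observed labels have positive probability, both losses of F are finite,
   because lam can be infinite only where it predicts the label with probability 0. *)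
Require Import Defs.
From Stdlib Require Import Reals QArith Qreals List Arith ZArith Lia Lra.
From Stdlib Require Import Classical ClassicalEpsilon.
From Coquelicot Require Import Rbar.
Import ListNotations.
Open Scope nat_scope.

(** * Partial recursive codes *)

Section EvalInd.
Variable g : nat -> nat.
Variable P : code -> list nat -> nat -> Prop.
Variable Q : list code -> list nat -> list nat -> Prop.
Hypothesis Hzero : forall xs, P CZero xs 0.
Hypothesis Hsucc : forall x xs, P CSucc (x :: xs) (S x).
Hypothesis Hproj : forall i xs, P (CProj i) xs (nth i xs 0).
Hypothesis Horacle : forall x xs, P COracle (x :: xs) (g x).
Hypothesis Hcomp : forall f gs xs ys v,
  evals g gs xs ys -> Q gs xs ys -> eval g f ys v -> P f ys v -> P (CComp f gs) xs v.
Hypothesis Hprec0 : forall f h xs v, eval g f xs v -> P f xs v -> P (CPrec f h) (0 :: xs) v.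
Hypothesis HprecS : forall f h n xs r v,
  eval g (CPrec f h) (n :: xs) r -> P (CPrec f h) (n :: xs) r ->
  eval g h (n :: r :: xs) v -> P h (n :: r :: xs) v -> P (CPrec f h) (S n :: xs) v.
Hypothesis Hmin : forall f xs n, eval g f (n :: xs) 0 -> P f (n :: xs) 0 ->
  (forall m, m < n -> exists w, eval g f (m :: xs) (S w) /\ P f (m :: xs) (S w)) ->
  P (CMin f) xs n.
Hypothesis Hnil : forall xs, Q [] xs [].
Hypothesis Hcons : forall c cs xs v vs, eval g c xs v -> P c xs v ->
  evals g cs xs vs -> Q cs xs vs -> Q (c :: cs) xs (v :: vs).

(* The automatic scheme gives no induction hypothesis for the derivations under
   the existential of [ev_min]. *)
Fixpoint eval_nested_ind c xs v (H : eval g c xs v) {struct H} : P c xs v :=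
  match H in eval _ c xs v return P c xs v with
  | ev_zero xs => Hzero xs
  | ev_succ x xs => Hsucc x xs
  | ev_proj i xs => Hproj i xs
  | ev_oracle x xs => Horacle x xs
  | ev_comp f gs xs ys v Hgs Hf =>
      Hcomp f gs xs ys v Hgs (evals_nested_ind _ _ _ Hgs) Hf (eval_nested_ind _ _ _ Hf)
  | ev_prec0 f h xs v Hf => Hprec0 f h xs v Hf (eval_nested_ind _ _ _ Hf)
  | ev_precS f h n xs r v Hr Hh =>
      HprecS f h n xs r v Hr (eval_nested_ind _ _ _ Hr) Hh (eval_nested_ind _ _ _ Hh)
  | ev_min f xs n H0 Hlt => Hmin f xs n H0 (eval_nested_ind _ _ _ H0)
      (fun m hm => match Hlt m hm with
                   | ex_intro w Hw => ex_intro _ w (conj Hw (eval_nested_ind _ _ _ Hw))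
                   end)
  end
with evals_nested_ind cs xs vs (H : evals g cs xs vs) {struct H} : Q cs xs vs :=
  match H in evals _ cs xs vs return Q cs xs vs with
  | evs_nil xs => Hnil xs
  | evs_cons c cs xs v vs Hc Hcs =>
      Hcons c cs xs v vs Hc (eval_nested_ind _ _ _ Hc) Hcs (evals_nested_ind _ _ _ Hcs)
  end.
End EvalInd.

(** In the [CMin] case two distinct results are incompatible: at the smaller one the body takes the
    value 0, but also a successor value, since it lies below the larger one. Determinism later
    identifies an arbitrary halting run with a known one. *)
Lemma eval_det g c xs v w : eval g c xs v -> eval g c xs w -> v = w.
Proof.
intros H; revert w.
apply (eval_nested_ind g (fun c xs v => forall w, eval g c xs w -> v = w)
  (fun cs xs vs => forall ws, evals g cs xs ws -> vs = ws)) with (11 := H).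
all: clear.
- intros xs w H; now inversion H.
- intros x xs w H; now inversion H.
- intros i xs w H; now inversion H.
- intros x xs w H; now inversion H.
- intros f gs xs ys v _ IHgs _ IHf w H; inversion H; subst.
  apply IHf. now rewrite (IHgs ys0).
- intros f h xs v _ IH w H; inversion H; subst. now apply IH.
- intros f h n xs r v _ IHr _ IHh w H; inversion H; subst.
  apply IHh. now rewrite (IHr r0).
- intros f xs n H0 IH0 Hlt w H; inversion H as [| | | | | | |f' xs' w' Hw0 Hwlt]; subst.
  destruct (lt_eq_lt_dec n w) as [[hl|]|hl]; trivial.
  + destruct (Hwlt _ hl) as [u Hu]. now specialize (IH0 _ Hu).
  + destruct (Hlt _ hl) as [u [_ IH]]. now specialize (IH _ Hw0).
- intros xs ws H; now inversion H.
- intros c cs xs v vs _ IHc _ IHcs ws H; inversion H; subst.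
  now rewrite (IHc v0), (IHcs vs0).
Qed.

(* [subst_oracle eF c n] replaces the oracle calls of [c], run on [n] arguments,
   by calls of [eF]; two parameters of [eF] are carried as two extra last arguments. *)
Fixpoint subst_oracle (eF : code) (c : code) (n : nat) : code :=
  match c with
  | CZero => CZero
  | CSucc => CSucc
  | CProj i => if i <? n then CProj i else CZero
  | COracle => CComp eF [CProj 0; CProj n; CProj (S n)]
  | CComp f gs => CComp (subst_oracle eF f (length gs))
                    (map (fun c => subst_oracle eF c n) gs ++ [CProj n; CProj (S n)])
  | CPrec f h => CPrec (subst_oracle eF f (pred n)) (subst_oracle eF h (S n))
  | CMin f => CMin (subst_oracle eF f (S n))
  end.

Lemma evals_length g cs xs vs : evals g cs xs vs -> length vs = length cs.
Proof. induction 1; simpl; congruence. Qed.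

Lemma eval_proj_eq g i xs v : nth i xs 0 = v -> eval g (CProj i) xs v.
Proof. intros <-; constructor. Qed.

Lemma nth_params xs a b :
  nth (length xs) (xs ++ [a; b]) 0 = a /\ nth (S (length xs)) (xs ++ [a; b]) 0 = b.
Proof.
rewrite !app_nth2 by lia. rewrite Nat.sub_diag.
now replace (S (length xs) - length xs) with 1 by lia.
Qed.

Lemma eval_subst_oracle g eF a b c xs v :
  (forall x, eval no_oracle eF [x; a; b] (g x)) ->
  eval g c xs v -> eval no_oracle (subst_oracle eF c (length xs)) (xs ++ [a; b]) v.
Proof.
intros HF H.
apply (eval_nested_ind g
  (fun c xs v => eval no_oracle (subst_oracle eF c (length xs)) (xs ++ [a; b]) v)
  (fun cs xs vs => evals no_oracle
     (map (fun c => subst_oracle eF c (length xs)) cs ++ [CProj (length xs); CProj (S (length xs))])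
     (xs ++ [a; b]) (vs ++ [a; b]))) with (11 := H); clear - HF; simpl.
- constructor.
- constructor.
(* Beyond the end [nth] yields 0, where the extended list could show a parameter: hence the [CZero]
   in [subst_oracle]. *)
- intros i xs. destruct (Nat.ltb_spec i (length xs)) as [h|h].
  + apply eval_proj_eq. now rewrite app_nth1.
  + rewrite nth_overflow by lia. constructor.
- intros x xs. destruct (nth_params (x :: xs) a b) as [h1 h2].
  apply ev_comp with [x; a; b]; [|apply HF].
  repeat constructor; now apply eval_proj_eq.
- intros f gs xs ys v Hgs IHgs _ IHf.
  rewrite <- (evals_length _ _ _ _ Hgs). now apply ev_comp with (ys ++ [a; b]).
- intros f h xs v _ IH. now constructor.
- intros f h n xs r v _ IHr _ IHh. now apply ev_precS with r.
- intros f xs n _ IH0 IH. constructor; [exact IH0|].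
  intros m hm. destruct (IH m hm) as [w [_ Hw]]. now exists w.
- intros xs. destruct (nth_params xs a b) as [h1 h2].
  repeat constructor; now apply eval_proj_eq.
- intros c cs xs v vs _ IHc _ IHcs. now constructor.
Qed.

(** * Closure properties of total recursive functions *)

Definition rec (r : nat) (f : list nat -> nat) : Prop :=
  exists e, forall xs, length xs = r -> eval no_oracle e xs (f xs).

Definition rec1 (h : nat -> nat) : Prop := exists e, forall x, eval no_oracle e [x] (h x).
Definition rec2 (h : nat -> nat -> nat) : Prop :=
  exists e, forall x y, eval no_oracle e [x; y] (h x y).
Definition rec3 (h : nat -> nat -> nat -> nat) : Prop :=
  exists e, forall x y z, eval no_oracle e [x; y; z] (h x y z).

Lemma rec_ext r f h : (forall xs, f xs = h xs) -> rec r f -> rec r h.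
Proof. intros E [e He]; exists e; intros xs hl. rewrite <- E. now apply He. Qed.

Lemma rec_proj r i : rec r (fun xs => nth i xs 0).
Proof. exists (CProj i). constructor. Qed.

Lemma rec_1 r h f : rec1 h -> rec r f -> rec r (fun xs => h (f xs)).
Proof.
intros [e He] [ef Hf]. exists (CComp e [ef]). intros xs hl.
apply ev_comp with [f xs]; [|apply He]. repeat constructor; auto.
Qed.

Lemma rec_2 r h f1 f2 : rec2 h -> rec r f1 -> rec r f2 -> rec r (fun xs => h (f1 xs) (f2 xs)).
Proof.
intros [e He] [e1 H1] [e2 H2]. exists (CComp e [e1; e2]). intros xs hl.
apply ev_comp with [f1 xs; f2 xs]; [|apply He]. repeat constructor; auto.
Qed.

Lemma rec_3 r h f1 f2 f3 : rec3 h -> rec r f1 -> rec r f2 -> rec r f3 ->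
  rec r (fun xs => h (f1 xs) (f2 xs) (f3 xs)).
Proof.
intros [e He] [e1 H1] [e2 H2] [e3 H3]. exists (CComp e [e1; e2; e3]). intros xs hl.
apply ev_comp with [f1 xs; f2 xs; f3 xs]; [|apply He]. repeat constructor; auto.
Qed.

Lemma rec_S r f : rec r f -> rec r (fun xs => S (f xs)).
Proof. apply rec_1. exists CSucc. constructor. Qed.

Lemma rec_const r n : rec r (fun _ => n).
Proof. induction n; [exists CZero; constructor|now apply rec_S]. Qed.

Lemma rec1_intro h : rec 1 (fun xs => h (nth 0 xs 0)) -> rec1 h.
Proof. intros [e He]; exists e; intros x; now apply (He [x]). Qed.

Lemma rec2_intro h : rec 2 (fun xs => h (nth 0 xs 0) (nth 1 xs 0)) -> rec2 h.
Proof. intros [e He]; exists e; intros x y; now apply (He [x; y]). Qed.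

Lemma rec3_intro h : rec 3 (fun xs => h (nth 0 xs 0) (nth 1 xs 0) (nth 2 xs 0)) -> rec3 h.
Proof. intros [e He]; exists e; intros x y z; now apply (He [x; y; z]). Qed.

Lemma evals_proj g xs : evals g (map CProj (seq 0 (length xs))) xs xs.
Proof.
enough (forall l ys, xs = ys ++ l -> evals g (map CProj (seq (length ys) (length l))) xs l)
  as H by exact (H xs [] eq_refl).
induction l as [|x l IH]; intros ys E; simpl; constructor.
- apply eval_proj_eq. subst. now rewrite nth_middle.
- specialize (IH (ys ++ [x])). rewrite length_app, Nat.add_1_r in IH.
  apply IH. now rewrite <- app_assoc.
Qed.

(** In the body, position 0 holds the counter, position 1 the accumulator, and the original
    arguments start at position 2. The projections copy these arguments behind the bound, which is
    where [CPrec] recurses. *)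
Lemma rec_iter r n a h : rec r n -> rec r a -> rec (S (S r)) h ->
  rec r (fun xs => nat_rect (fun _ => nat) (a xs) (fun i acc => h (i :: acc :: xs)) (n xs)).
Proof.
intros [en Hn] [ea Ha] [eh Hh].
exists (CComp (CPrec ea eh) (en :: map CProj (seq 0 r))). intros xs hl.
apply ev_comp with (n xs :: xs).
- constructor; [now apply Hn|]. rewrite <- hl. apply evals_proj.
- induction (n xs) as [|i IH]; simpl.
  + constructor. now apply Ha.
  + apply ev_precS with (1 := IH). apply Hh. simpl. now rewrite hl.
Qed.

Create HintDb rec.
Ltac rec_tac :=
  lazymatch goal with
  | |- rec1 _ => first [solve [auto with rec] | apply rec1_intro; cbv beta; rec_tac]
  | |- rec2 _ => first [solve [auto with rec] | apply rec2_intro; cbv beta; rec_tac]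
  | |- rec3 _ => first [solve [auto with rec] | apply rec3_intro; cbv beta; rec_tac]
  | |- rec _ (fun xs => nth ?i xs 0) => apply rec_proj
  | |- rec _ (fun _ => ?n) => apply rec_const
  | |- rec _ (fun xs => S (@?f xs)) => apply rec_S; rec_tac
  | |- rec _ (fun xs => ?h (@?f xs) (@?g xs) (@?k xs)) =>
      apply (rec_3 _ h f g k); [solve [auto with rec] | rec_tac | rec_tac | rec_tac]
  | |- rec _ (fun xs => ?h (@?f xs) (@?g xs)) =>
      apply (rec_2 _ h f g); [solve [auto with rec] | rec_tac | rec_tac]
  | |- rec _ (fun xs => ?h (@?f xs)) =>
      apply (rec_1 _ h f); [solve [auto with rec] | rec_tac]
  end.

Ltac rec_iter_tac n a h :=
  match goal with
  | |- rec ?r _ => eapply rec_ext;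
      [|apply (rec_iter r n a h); [rec_tac | rec_tac | cbv beta; rec_tac]]; cbv beta
  end.

(** * Arithmetic, parity and Cantor pairing as recursive functions *)

Lemma rec1_pred : rec1 pred.
Proof.
apply rec1_intro.
rec_iter_tac (fun xs => nth 0 xs 0) (fun _ : list nat => 0) (fun xs => nth 0 xs 0).
intros xs. now destruct (nth 0 xs 0).
Qed.
#[local] Hint Resolve rec1_pred : rec.

Lemma rec2_add : rec2 Nat.add.
Proof.
apply rec2_intro.
rec_iter_tac (fun xs => nth 0 xs 0) (fun xs => nth 1 xs 0) (fun xs => S (nth 1 xs 0)).
intros xs. simpl. induction (nth 0 xs 0); simpl; congruence.
Qed.
#[local] Hint Resolve rec2_add : rec.

Lemma rec2_sub : rec2 Nat.sub.
Proof.
apply rec2_intro.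
rec_iter_tac (fun xs => nth 1 xs 0) (fun xs => nth 0 xs 0) (fun xs => pred (nth 1 xs 0)).
intros xs. simpl. induction (nth 1 xs 0) as [|n IH]; simpl; [lia|]. rewrite IH. lia.
Qed.
#[local] Hint Resolve rec2_sub : rec.

Lemma rec2_mul : rec2 Nat.mul.
Proof.
apply rec2_intro.
rec_iter_tac (fun xs => nth 0 xs 0) (fun _ : list nat => 0)
  (fun xs => nth 3 xs 0 + nth 1 xs 0).
intros xs. simpl. induction (nth 0 xs 0); simpl; congruence.
Qed.
#[local] Hint Resolve rec2_mul : rec.

Lemma rec2_pow : rec2 Nat.pow.
Proof.
apply rec2_intro.
rec_iter_tac (fun xs => nth 1 xs 0) (fun _ : list nat => 1)
  (fun xs => nth 2 xs 0 * nth 1 xs 0).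
intros xs. simpl. induction (nth 1 xs 0); simpl; congruence.
Qed.
#[local] Hint Resolve rec2_pow : rec.

(** These are written as bare [nat_rect] terms to be instances of [rec_iter] by conversion. The
    triangular numbers [tri] replace the division in [pairN]. *)
Definition isodd (n : nat) : nat := nat_rect (fun _ => nat) 0 (fun _ r => 1 - r) n.
Definition half (n : nat) : nat := nat_rect (fun _ => nat) 0 (fun i r => r + isodd i) n.
Definition tri (n : nat) : nat := nat_rect (fun _ => nat) 0 (fun i r => r + S i) n.

Lemma rec1_isodd : rec1 isodd.
Proof.
apply rec1_intro.
rec_iter_tac (fun xs => nth 0 xs 0) (fun _ : list nat => 0) (fun xs => 1 - nth 1 xs 0).
reflexivity.
Qed.
#[local] Hint Resolve rec1_isodd : rec.

Lemma rec1_half : rec1 half.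
Proof.
apply rec1_intro.
rec_iter_tac (fun xs => nth 0 xs 0) (fun _ : list nat => 0)
  (fun xs => nth 1 xs 0 + isodd (nth 0 xs 0)).
reflexivity.
Qed.
#[local] Hint Resolve rec1_half : rec.

Lemma rec1_tri : rec1 tri.
Proof.
apply rec1_intro.
rec_iter_tac (fun xs => nth 0 xs 0) (fun _ : list nat => 0)
  (fun xs => nth 1 xs 0 + S (nth 0 xs 0)).
reflexivity.
Qed.
#[local] Hint Resolve rec1_tri : rec.

Lemma half_isodd n : n = 2 * half n + isodd n /\ isodd n <= 1.
Proof.
induction n as [|n IH]; [split; [reflexivity|apply Nat.le_0_l]|].
change (half (S n)) with (half n + isodd n). change (isodd (S n)) with (1 - isodd n). lia.
Qed.

Lemma half_double n : half (2 * n) = n /\ isodd (2 * n) = 0.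
Proof. destruct (half_isodd (2 * n)); lia. Qed.

Lemma half_double_pred n : 0 < n ->
  half (S (2 * n - 1)) = n /\ isodd (2 * n - 1) = 1.
Proof. intros h. destruct (half_isodd (2 * n - 1)), (half_isodd (S (2 * n - 1))); lia. Qed.

Lemma double_tri n : 2 * tri n = n * (n + 1).
Proof. induction n; [reflexivity|]. change (tri (S n)) with (tri n + S n). lia. Qed.

Lemma pairN_tri a b : pairN a b = tri (a + b) + b.
Proof.
unfold pairN. rewrite <- double_tri, (Nat.mul_comm 2), Nat.div_mul; lia.
Qed.

Lemma rec2_pairN : rec2 pairN.
Proof.
apply rec2_intro. eapply rec_ext; [intros xs; symmetry; apply pairN_tri|]. rec_tac.
Qed.
#[local] Hint Resolve rec2_pairN : rec.

Lemma tri_S n : tri (S n) = tri n + S n.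
Proof. reflexivity. Qed.

Lemma pairN_unpairN m : pairN (fst (unpairN m)) (snd (unpairN m)) = m.
Proof.
induction m as [|m IH]; [reflexivity|]. cbn [unpairN].
destruct (unpairN m) as [[|a] b]; cbn [fst snd] in *; rewrite pairN_tri in *.
- rewrite !Nat.add_0_r. rewrite tri_S. cbn [Nat.add] in IH. lia.
- rewrite !Nat.add_succ_r. cbn [Nat.add] in *. lia.
Qed.

Lemma unpairN_pairN a b : unpairN (pairN a b) = (a, b).
Proof.
(* The induction follows the code, since one step of [unpairN] changes both components. *)
enough (forall m a b, pairN a b = m -> unpairN m = (a, b)) as H by now apply H.
clear. induction m as [|m IH]; intros a b E.
- rewrite pairN_tri in E. destruct b; [|lia]. rewrite !Nat.add_0_r in E.
  destruct a; [reflexivity|]. rewrite tri_S in E. lia.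
- simpl. rewrite pairN_tri in E. destruct b as [|b].
  + destruct a as [|a]; [discriminate|]. rewrite (IH 0 a); [reflexivity|].
    rewrite pairN_tri. rewrite !Nat.add_0_r in E.
    rewrite tri_S in E. cbn [Nat.add]. lia.
  + rewrite (IH (S a) b); [reflexivity|].
    rewrite pairN_tri. rewrite !Nat.add_succ_r in E. cbn [Nat.add] in *. lia.
Qed.

Definition unfst (m : nat) : nat := fst (unpairN m).
Definition unsnd (m : nat) : nat := snd (unpairN m).

Lemma unfst_pairN a b : unfst (pairN a b) = a.
Proof. unfold unfst. now rewrite unpairN_pairN. Qed.

Lemma unsnd_pairN a b : unsnd (pairN a b) = b.
Proof. unfold unsnd. now rewrite unpairN_pairN. Qed.

(* Index of the diagonal of [m]: it moves on exactly when [S m] is triangular. *)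
Definition diag (m : nat) : nat :=
  nat_rect (fun _ => nat) 0 (fun i w => w + (1 - (tri (S w) - S i))) m.

Lemma rec1_diag : rec1 diag.
Proof.
apply rec1_intro.
rec_iter_tac (fun xs => nth 0 xs 0) (fun _ : list nat => 0)
  (fun xs => nth 1 xs 0 + (1 - (tri (S (nth 1 xs 0)) - S (nth 0 xs 0)))).
reflexivity.
Qed.
#[local] Hint Resolve rec1_diag : rec.

(** [unpairN] iterates on pairs, while a recursion on numbers carries one value. The diagonal index
    suffices: both components are recovered from it by subtraction. *)
Lemma diag_unpairN m : diag m = unfst m + unsnd m.
Proof.
induction m as [|m IH]; [reflexivity|].
change (diag (S m)) with (diag m + (1 - (tri (S (diag m)) - S m))). rewrite IH.
pose proof (pairN_unpairN m) as E. rewrite pairN_tri in E.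
rewrite tri_S. unfold unfst, unsnd in *. cbn [unpairN].
destruct (unpairN m) as [[|a] b]; cbn [fst snd] in *; lia.
Qed.

Lemma unsnd_diag m : m - tri (diag m) = unsnd m.
Proof.
rewrite diag_unpairN. pose proof (pairN_unpairN m) as E. rewrite pairN_tri in E.
unfold unfst, unsnd. lia.
Qed.

Lemma rec1_unsnd : rec1 unsnd.
Proof. apply rec1_intro. eapply rec_ext; [intros xs; apply unsnd_diag|]. rec_tac. Qed.
#[local] Hint Resolve rec1_unsnd : rec.

Lemma rec1_unfst : rec1 unfst.
Proof.
apply rec1_intro.
apply rec_ext with (fun xs => diag (nth 0 xs 0) - unsnd (nth 0 xs 0)); [|rec_tac].
intros xs. rewrite diag_unpairN. lia.
Qed.
#[local] Hint Resolve rec1_unfst : rec.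

(** * Rational arithmetic on codes *)

(** Positive and negative part of the numerator: [zdec] reads even codes as nonnegative integers and
    odd codes as negative ones, so all arithmetic stays in the natural numbers. *)
Definition qpos (m : nat) : nat := (1 - isodd (unfst m)) * half (unfst m).
Definition qneg (m : nat) : nat := isodd (unfst m) * half (S (unfst m)).
Definition qden (m : nat) : nat := S (unsnd m).
(* By truncation at most one of the two summands is nonzero: the sum is the number that
   [zdec] reads as the integer [p - n]. *)
Definition qmk (p n d : nat) : nat := pairN (2 * (p - n) + (2 * (n - p) - 1)) (pred d).

Lemma rec1_qpos : rec1 qpos.
Proof. unfold qpos. rec_tac. Qed.
Lemma rec1_qneg : rec1 qneg.
Proof. unfold qneg. rec_tac. Qed.
Lemma rec1_qden : rec1 qden.
Proof. unfold qden. rec_tac. Qed.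
Lemma rec3_qmk : rec3 qmk.
Proof. unfold qmk. rec_tac. Qed.
#[local] Hint Resolve rec1_qpos rec1_qneg rec1_qden rec3_qmk : rec.

Definition qnat (n : nat) : nat := qmk n 0 1.
Definition qadd (a b : nat) : nat :=
  qmk (qpos a * qden b + qpos b * qden a) (qneg a * qden b + qneg b * qden a) (qden a * qden b).
Definition qopp (a : nat) : nat := qmk (qneg a) (qpos a) (qden a).
Definition qsub (a b : nat) : nat := qadd a (qopp b).
Definition qmul (a b : nat) : nat :=
  qmk (qpos a * qpos b + qneg a * qneg b) (qpos a * qneg b + qneg a * qpos b) (qden a * qden b).
(* Correct on positive rationals only. *)
Definition qinv (a : nat) : nat := qmk (qden a) 0 (qpos a - qneg a).
Definition qpow (a n : nat) : nat := nat_rect (fun _ => nat) (qnat 1) (fun _ r => qmul a r) n.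
(** A test is a number that vanishes on success: a sum is then a conjunction, and [CMin] can search
    for it. *)
Definition qgt (a b : nat) : nat :=
  (qpos a * qden b + qneg b * qden a) - (qpos b * qden a + qneg a * qden b).

Lemma rec1_qnat : rec1 qnat.
Proof. unfold qnat. rec_tac. Qed.
Lemma rec2_qadd : rec2 qadd.
Proof. unfold qadd. rec_tac. Qed.
Lemma rec1_qopp : rec1 qopp.
Proof. unfold qopp. rec_tac. Qed.
#[local] Hint Resolve rec1_qnat rec2_qadd rec1_qopp : rec.
Lemma rec2_qsub : rec2 qsub.
Proof. unfold qsub. rec_tac. Qed.
Lemma rec2_qmul : rec2 qmul.
Proof. unfold qmul. rec_tac. Qed.
Lemma rec1_qinv : rec1 qinv.
Proof. unfold qinv. rec_tac. Qed.
Lemma rec2_qgt : rec2 qgt.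
Proof. unfold qgt. rec_tac. Qed.
#[local] Hint Resolve rec2_qsub rec2_qmul rec1_qinv rec2_qgt : rec.
Lemma rec2_qpow : rec2 qpow.
Proof.
apply rec2_intro.
rec_iter_tac (fun xs => nth 1 xs 0) (fun _ : list nat => qnat 1)
  (fun xs => qmul (nth 2 xs 0) (nth 1 xs 0)).
reflexivity.
Qed.
#[local] Hint Resolve rec2_qpow : rec.

Open Scope R_scope.

(** * Correctness of the rational operations *)

Lemma Q2R_make z d : Q2R (z # d) = IZR z / IZR (Zpos d).
Proof. reflexivity. Qed.

Lemma zdec_isodd n :
  IZR (zdec n) = INR ((1 - isodd n) * half n) - INR (isodd n * half (S n)).
Proof.
destruct (half_isodd n) as [E h1], (half_isodd (S n)) as [E' h1'].
unfold zdec. rewrite !Nat.div2_div.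
destruct (Nat.even n) eqn:ev.
- apply Nat.even_spec in ev. destruct ev as [j ->].
  rewrite (Nat.mul_comm 2 j), Nat.div_mul, (Nat.mul_comm j 2) by lia.
  destruct (half_double j) as [-> ->]. rewrite Nat.mul_1_l, Nat.mul_0_l, <- INR_IZR_INZ.
  simpl (INR 0). ring.
- assert (Nat.odd n = true) as od by (unfold Nat.odd; now rewrite ev).
  apply Nat.odd_spec in od. destruct od as [j ->].
  replace (S (2 * j + 1)) with (S j * 2)%nat in * by lia.
  rewrite Nat.div_mul by lia.
  replace (isodd (2 * j + 1)) with 1%nat in * by lia.
  replace (half (S j * 2)) with (S j) by lia.
  rewrite opp_IZR, <- INR_IZR_INZ, Nat.sub_diag, Nat.mul_1_l, Nat.mul_0_l. simpl (INR 0). ring.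
Qed.

Lemma qR_eq m : qR m = (INR (qpos m) - INR (qneg m)) / INR (qden m).
Proof.
unfold qR, decQ, qpos, qneg, qden, unfst, unsnd.
destruct (unpairN m) as [a b]. cbn [fst snd].
rewrite Q2R_make, zdec_isodd. f_equal.
now rewrite INR_IZR_INZ.
Qed.

Lemma qden_gt0 m : 0 < INR (qden m).
Proof. unfold qden. apply lt_0_INR. lia. Qed.

Lemma qR_qmk p n d : (0 < d)%nat -> qR (qmk p n d) = (INR p - INR n) / INR d.
Proof.
intros hd. rewrite qR_eq. unfold qmk, qpos, qneg, qden. rewrite unfst_pairN, unsnd_pairN.
rewrite (Nat.lt_succ_pred 0 d hd). f_equal.
destruct (le_lt_dec n p) as [h|h].
- replace (2 * (p - n) + (2 * (n - p) - 1))%nat with (2 * (p - n))%nat by lia.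
  destruct (half_double (p - n)) as [-> ->].
  rewrite Nat.mul_0_l, Nat.mul_1_l, minus_INR by lia. simpl (INR 0). ring.
- replace (2 * (p - n) + (2 * (n - p) - 1))%nat with (2 * (n - p) - 1)%nat by lia.
  destruct (half_double_pred (n - p)) as [-> ->]; [lia|].
  rewrite Nat.mul_0_l, Nat.mul_1_l, minus_INR by lia. simpl (INR 0). ring.
Qed.

Lemma qR_qnat n : qR (qnat n) = INR n.
Proof. unfold qnat. rewrite qR_qmk by lia. simpl. field. Qed.

Ltac qR_field :=
  rewrite qR_qmk by (unfold qden; simpl; lia); rewrite !qR_eq;
  repeat rewrite ?plus_INR, ?mult_INR; field; split; apply Rgt_not_eq, qden_gt0.

Lemma qR_qadd a b : qR (qadd a b) = qR a + qR b.
Proof. unfold qadd. qR_field. Qed.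

Lemma qR_qmul a b : qR (qmul a b) = qR a * qR b.
Proof. unfold qmul. qR_field. Qed.

Lemma qR_qopp a : qR (qopp a) = - qR a.
Proof.
unfold qopp. rewrite qR_qmk by (unfold qden; lia). rewrite qR_eq. field.
apply Rgt_not_eq, qden_gt0.
Qed.

Lemma qR_qsub a b : qR (qsub a b) = qR a - qR b.
Proof. unfold qsub. rewrite qR_qadd, qR_qopp. ring. Qed.

Lemma qR_num a : INR (qpos a) - INR (qneg a) = qR a * INR (qden a).
Proof. rewrite qR_eq. field. apply Rgt_not_eq, qden_gt0. Qed.

Lemma qR_qinv a : 0 < qR a -> qR (qinv a) = / qR a.
Proof.
intros h.
assert (INR (qneg a) < INR (qpos a)) as hlt.
{ enough (0 < INR (qpos a) - INR (qneg a)) by lra. rewrite qR_num.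
  apply Rmult_lt_0_compat; [exact h|apply qden_gt0]. }
apply INR_lt in hlt. unfold qinv. rewrite qR_qmk, minus_INR, qR_num by lia.
simpl (INR 0). field. split; [lra|]. apply Rgt_not_eq, qden_gt0.
Qed.

Lemma qR_qpow a n : qR (qpow a n) = qR a ^ n.
Proof.
induction n as [|n IH]; [exact (qR_qnat 1)|].
change (qpow a (S n)) with (qmul a (qpow a n)). now rewrite qR_qmul, IH.
Qed.

Lemma qgt_eq0 a b : qgt a b = 0%nat <-> qR a <= qR b.
Proof.
pose proof (qden_gt0 a) as ha. pose proof (qden_gt0 b) as hb.
pose proof (qR_num a) as Ea. pose proof (qR_num b) as Eb.
assert (qR b - qR a = (INR (qpos b * qden a + qneg a * qden b) -
  INR (qpos a * qden b + qneg b * qden a)) / (INR (qden a) * INR (qden b))) as E.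
{ rewrite !qR_eq. repeat rewrite ?plus_INR, ?mult_INR. field. split; now apply Rgt_not_eq. }
pose proof (Rmult_lt_0_compat _ _ ha hb) as hab.
unfold qgt. rewrite Nat.sub_0_le.
set (l := (qpos a * _ + _)%nat) in *. set (r := (qpos b * _ + _)%nat) in *.
clearbody l r. split; intros h.
- apply le_INR in h. enough (0 <= qR b - qR a) by lra. rewrite E.
  apply Rmult_le_pos; [lra|]. now apply Rlt_le, Rinv_0_lt_compat.
- apply INR_le. enough (0 <= INR r - INR l) by lra.
  replace (_ - _) with ((qR b - qR a) * (INR (qden a) * INR (qden b)))
    by (rewrite E; field; split; now apply Rgt_not_eq).
  apply Rmult_le_pos; lra.
Qed.

(* Prefixes are obtained by reversing [t] items twice. *)
Definition cons_code (z c : nat) : nat := S (pairN z c).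
Definition rev_step (st : nat) : nat :=
  pairN (cons_code (unfst (pred (unsnd st))) (unfst st)) (unsnd (pred (unsnd st))).
Definition rev_code (t c : nat) : nat :=
  unfst (nat_rect (fun _ => nat) (pairN 0 c) (fun _ st => rev_step st) t).
Definition firstn_code (t c : nat) : nat := rev_code t (rev_code t c).
Definition skipn_code (t c : nat) : nat :=
  nat_rect (fun _ => nat) c (fun _ r => unsnd (pred r)) t.
Definition nth_code (t c : nat) : nat := unfst (pred (skipn_code t c)).

Lemma rec2_cons_code : rec2 cons_code.
Proof. unfold cons_code. rec_tac. Qed.
#[local] Hint Resolve rec2_cons_code : rec.
Lemma rec1_rev_step : rec1 rev_step.
Proof. unfold rev_step. rec_tac. Qed.
#[local] Hint Resolve rec1_rev_step : rec.
Lemma rec2_rev_code : rec2 rev_code.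
Proof.
apply rec2_intro. apply rec_1; [auto with rec|].
rec_iter_tac (fun xs => nth 0 xs 0%nat) (fun xs : list nat => pairN 0 (nth 1 xs 0%nat))
  (fun xs => rev_step (nth 1 xs 0%nat)).
reflexivity.
Qed.
#[local] Hint Resolve rec2_rev_code : rec.
Lemma rec2_firstn_code : rec2 firstn_code.
Proof. unfold firstn_code. rec_tac. Qed.
Lemma rec2_skipn_code : rec2 skipn_code.
Proof.
apply rec2_intro.
rec_iter_tac (fun xs => nth 0 xs 0%nat) (fun xs : list nat => nth 1 xs 0%nat)
  (fun xs => unsnd (pred (nth 1 xs 0%nat))).
reflexivity.
Qed.
#[local] Hint Resolve rec2_firstn_code rec2_skipn_code : rec.
Lemma rec2_nth_code : rec2 nth_code.
Proof. unfold nth_code. rec_tac. Qed.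
#[local] Hint Resolve rec2_nth_code : rec.

(** * Codes of data sequences: prefixes, items, length *)

Section Lists.
Context {k : nat}.
Implicit Types (s u : list (Zt k)) (z : Zt k).

Lemma skipn_code_encS s t : skipn_code t (encS s) = encS (skipn t s).
Proof.
induction t as [|t IH]; [reflexivity|].
change (skipn_code (S t) (encS s)) with (unsnd (pred (skipn_code t (encS s)))).
rewrite IH. clear IH. revert t. induction s as [|z s IH]; intros [|t]; try reflexivity.
- exact (unsnd_pairN (encZ z) (encS s)).
- exact (IH t).
Qed.

(** Loop invariant: the first component collects the consumed items in reverse order, the second
    keeps the untouched rest. *)
Lemma rev_code_encS s u :
  nat_rect (fun _ => nat) (pairN 0 (encS (s ++ u))) (fun _ st => rev_step st) (length s)
  = pairN (encS (rev s)) (encS u).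
Proof.
revert u. induction s as [|z s IH] using rev_ind; intros u; [reflexivity|].
rewrite length_app, Nat.add_1_r, <- app_assoc. cbn [nat_rect].
rewrite IH. unfold rev_step. rewrite unsnd_pairN, unfst_pairN, rev_app_distr.
cbn [app encS rev pred]. now rewrite unsnd_pairN, unfst_pairN.
Qed.

Lemma firstn_code_encS s u : firstn_code (length s) (encS (s ++ u)) = encS s.
Proof.
unfold firstn_code, rev_code. rewrite rev_code_encS, unfst_pairN.
pose proof (rev_code_encS (rev s) []) as E.
rewrite length_rev, app_nil_r, rev_involutive in E. now rewrite E, unfst_pairN.
Qed.

Lemma nth_code_encS s u (x : Obj k) (y : bool) :
  nth_code (length s) (encS (s ++ (x, y) :: u)) = pairN (proj1_sig x) (Nat.b2n y).
Proof.
unfold nth_code. rewrite skipn_code_encS, skipn_app, skipn_all, Nat.sub_diag.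
apply unfst_pairN.
Qed.

(** The code 0 stands for the empty list alone, so the length is the least number of items whose
    removal leaves 0. *)
Definition length_code : code :=
  CMin (let (e, _) := constructive_indefinite_description _ rec2_skipn_code in e).

Lemma eval_length_code s : eval no_oracle length_code [encS s] (length s).
Proof.
unfold length_code. destruct constructive_indefinite_description as [e He].
constructor.
- specialize (He (length s) (encS s)). now rewrite skipn_code_encS, skipn_all in He.
- intros m hm. specialize (He m (encS s)). rewrite skipn_code_encS in He.
  destruct (skipn m s) as [|z u] eqn:E; [|eauto].
  apply (f_equal (@length _)) in E. rewrite length_skipn in E. simpl in E. lia.
Qed.

End Lists.

(** * Certificates for approximate losses *)

Lemma nat_floor x : 0 <= x -> exists n : nat, INR n <= x < INR n + 1.
Proof.
intros hx. destruct (archimed x) as [h1 h2].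
assert (0 < up x)%Z as hup by (apply lt_IZR; lra).
exists (Z.to_nat (up x - 1)). rewrite INR_IZR_INZ, Z2Nat.id by lia.
rewrite minus_IZR. lra.
Qed.

Lemma pow2_inv_gt0 n : 0 < / 2 ^ n.
Proof. apply Rinv_0_lt_compat, pow_lt. lra. Qed.

Lemma pow2_inv_small eps : 0 < eps -> exists n0, forall n, (n0 <= n)%nat -> / 2 ^ n <= eps.
Proof.
intros he.
destruct (pow_lt_1_zero (/ 2)) with (y := eps) as [n0 H]; [|exact he|].
{ rewrite Rabs_pos_eq; lra. }
exists n0. intros n hn. specialize (H n hn). rewrite pow_inv, Rabs_pos_eq in H.
- now apply Rlt_le.
- apply Rlt_le, pow2_inv_gt0.
Qed.

Lemma exp_pow x n : exp x ^ n = exp (INR n * x).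
Proof.
induction n as [|n IH]; [now rewrite Rmult_0_l, exp_0|].
rewrite S_INR, Rmult_plus_distr_r, exp_plus, <- IH, Rmult_1_l. simpl. ring.
Qed.

Lemma ln_le x y : 0 < x -> x <= y -> ln x <= ln y.
Proof. intros hx [h|<-]; [|lra]. now apply Rlt_le, ln_increasing. Qed.

(** The bound 1 + x <= exp x at a negative x, inverted. Such reverse estimates, at the price of
    shifting N by one, make certificates attainable. *)
Lemma one_plus_inv_ge N : 0 < N -> exp (/ (N + 1)) <= 1 + / N.
Proof.
intros hN. pose proof (exp_ineq1_le (- / (N + 1))) as h. rewrite exp_Ropp in h.
pose proof (exp_pos (/ (N + 1))) as he.
replace (1 + / N) with (/ (1 + - / (N + 1))) by (field; lra).
rewrite <- (Rinv_inv (exp _)). apply Rinv_le_contravar; [|exact h].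
replace (1 + - / (N + 1)) with (N * / (N + 1)) by (field; lra).
apply Rmult_lt_0_compat; [lra|]. apply Rinv_0_lt_compat. lra.
Qed.

Lemma one_minus_inv_ge N : 1 < N -> exp (- / (N - 1)) <= 1 - / N.
Proof.
intros hN. pose proof (exp_ineq1_le (/ (N - 1))) as h. rewrite exp_Ropp.
replace (1 - / N) with (/ (1 + / (N - 1))) by (field; lra).
apply Rinv_le_contravar; [|exact h].
assert (0 < / (N - 1)) by (apply Rinv_0_lt_compat; lra). lra.
Qed.

Lemma exp_neg_ln p : 0 < p -> exp (- - ln p) = p.
Proof. intros hp. rewrite Ropp_involutive. now apply exp_ln. Qed.

(** Since (1 + 1/N)^j <= exp (j/N), the rational test gives p exp (j/N) >= 1. Positivity of p is a
    conclusion, so an impossible label has no certificate. *)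
Lemma log_upper_cert lo p N j :
  0 < N -> lo <= p -> 1 <= lo * (1 + / N) ^ j -> 0 < p /\ - ln p <= INR j / N.
Proof.
intros hN hlo h. pose proof (Rinv_0_lt_compat _ hN) as hi.
assert (0 < (1 + / N) ^ j) as hpow by (apply pow_lt; lra).
assert (0 < p) as hp by nra. split; [exact hp|].
assert ((1 + / N) ^ j <= exp (INR j / N)) as hexp.
{ unfold Rdiv. rewrite <- exp_pow. apply pow_incr.
  split; [lra|apply exp_ineq1_le]. }
pose proof (exp_pos (INR j / N)) as he.
assert (0 <= ln (p * exp (INR j / N))) as hl.
{ rewrite <- ln_1. apply ln_le; nra. }
rewrite ln_mult, ln_exp in hl by assumption. lra.
Qed.

(** The case i = 0 is exempt from the test: for p = 1 the bound [hi] may exceed 1, and yet 0 <= - ln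
    p is clear. *)
Lemma log_lower_cert hi p N i :
  1 <= N -> 0 < p <= 1 -> p <= hi -> i = 0%nat \/ hi <= (1 - / N) ^ i -> INR i / N <= - ln p.
Proof.
intros hN hp hhi [->|h].
- simpl. assert (ln p <= ln 1) by (apply ln_le; lra). rewrite ln_1 in *. lra.
- assert (/ N <= 1) as hN1 by (rewrite <- Rinv_1; apply Rinv_le_contravar; lra).
  assert ((1 - / N) ^ i <= exp (- (INR i / N))) as hexp.
  { replace (- (INR i / N)) with (INR i * - / N) by (unfold Rdiv; ring). rewrite <- exp_pow.
    apply pow_incr. split; [lra|]. apply exp_ineq1_le. }
  assert (ln p <= ln (exp (- (INR i / N)))) as hl by (apply ln_le; lra).
  rewrite ln_exp in hl. lra.
Qed.

Lemma log_cert_exists p delta : 0 < p <= 1 -> 0 < delta ->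
  exists N i j : nat, 1 < p * (1 + / INR (S N)) ^ j /\
    (i = 0%nat \/ p < (1 - / INR (S N)) ^ i) /\
    (INR j - INR i) * / INR (S N) <= delta.
Proof.
intros hp hd. set (l := - ln p).
assert (0 <= l) as hl.
{ assert (ln p <= ln 1) by (apply ln_le; lra). rewrite ln_1 in *. unfold l. lra. }
assert (p = exp (- l)) as Ep by (unfold l; now rewrite exp_neg_ln).
(* The upper index exceeds l (M + 1) by at most 1 and the lower one falls short of l (M - 1) by at
   most 2, so they differ by at most 2 l + 3. The summand 2 keeps M - 1 positive. Both indices move
   one step off the floor to make the inequalities strict, which leaves room for approximate
   inputs. *)
destruct (nat_floor ((2 * l + 3) / delta + 2)) as [N hN].
{ apply Rplus_le_le_0_compat; [|lra]. apply Rmult_le_pos; [lra|].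
  now apply Rlt_le, Rinv_0_lt_compat. }
assert ((2 * l + 3) / delta + 2 < INR (S N)) as hSN by (rewrite S_INR; lra).
assert (0 <= (2 * l + 3) / delta) as hq.
{ apply Rmult_le_pos; [lra|]. now apply Rlt_le, Rinv_0_lt_compat. }
remember (INR (S N)) as M eqn:EM.
destruct (nat_floor (l * (M + 1))) as [j hj]; [nra|].
destruct (nat_floor (l * (M - 1))) as [i hi]; [nra|].
exists N, (pred i), (S j). rewrite <- EM. clear hN EM. split; [|split].
- apply Rlt_le_trans with (p * exp (/ (M + 1)) ^ S j).
  + rewrite exp_pow, Ep, <- exp_plus. rewrite <- exp_0 at 1. apply exp_increasing.
    enough (l < INR (S j) * / (M + 1)) by lra.
    apply Rmult_lt_reg_r with (M + 1); [lra|].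
    rewrite Rmult_assoc, Rinv_l, Rmult_1_r, S_INR by lra. lra.
  + apply Rmult_le_compat_l; [lra|]. apply pow_incr.
    split; [apply Rlt_le, exp_pos|]. apply one_plus_inv_ge. lra.
- destruct i as [|i]; [now left|right]. simpl pred.
  apply Rlt_le_trans with (exp (- / (M - 1)) ^ i).
  + rewrite exp_pow, Ep. apply exp_increasing.
    enough (INR i * / (M - 1) < l) by lra.
    apply Rmult_lt_reg_r with (M - 1); [lra|].
    rewrite Rmult_assoc, Rinv_l, Rmult_1_r by lra. rewrite S_INR in hi. lra.
  + apply pow_incr. split; [apply Rlt_le, exp_pos|]. apply one_minus_inv_ge. lra.
- apply Rmult_le_reg_r with M; [lra|]. rewrite Rmult_assoc, Rinv_l, Rmult_1_r by lra.
  apply Rle_trans with (2 * l + 3).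
  + rewrite S_INR. destruct i as [|i]; simpl pred; [simpl (INR 0) in *; nra|].
    rewrite S_INR in hi. nra.
  + assert ((2 * l + 3) / delta * delta < M * delta) as h
      by (apply Rmult_lt_compat_r; lra).
    unfold Rdiv in h. rewrite Rmult_assoc, Rinv_l in h; lra.
Qed.

(** Inverse of [squash] on [0, 1), the image of the finite nonnegative losses. *)
Definition odds (x : R) : R := x / (1 - x).

Lemma odds_incr x y : x <= y -> y < 1 -> odds x <= odds y.
Proof.
intros h hy. unfold odds.
replace (x / (1 - x)) with (/ (1 - x) - 1) by (field; lra).
replace (y / (1 - y)) with (/ (1 - y) - 1) by (field; lra).
assert (/ (1 - x) <= / (1 - y)) by (apply Rinv_le_contravar; lra). lra.
Qed.

Lemma odds_squash v : 0 <= v -> odds (v / (1 + v)) = v.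
Proof. intros hv. unfold odds. field. lra. Qed.

Lemma odds_continuous x delta : x < 1 -> 0 < delta ->
  exists eps, 0 < eps /\ forall e, 0 <= e <= eps ->
    x + e < 1 /\ odds (x + e) - odds (x - e) <= delta.
Proof.
intros hx hd. set (d := 1 - x).
assert (0 < d) as hd0 by (unfold d; lra).
assert (0 < delta * d ^ 2 / 4) as h4.
{ apply Rdiv_lt_0_compat; [|lra]. apply Rmult_lt_0_compat; [exact hd|]. now apply pow_lt. }
(* For e <= d / 2 the denominator (d - e) (d + e) is at least d^2 / 2, and the second bound makes 2
   e at most delta d^2 / 2. *)
exists (Rmin (d / 2) (delta * d ^ 2 / 4)). split; [apply Rmin_pos; lra|].
intros e [he0 he].
pose proof (Rle_trans _ _ _ he (Rmin_l _ _)) as he1.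
pose proof (Rle_trans _ _ _ he (Rmin_r _ _)) as he2. clear he.
split; [unfold d in *; lra|].
replace (odds (x + e) - odds (x - e)) with (2 * e / ((d - e) * (d + e)))
  by (unfold odds, d in *; field; lra).
assert (0 < (d - e) * (d + e)) as hden by nra.
apply Rmult_le_reg_r with ((d - e) * (d + e)); [exact hden|].
unfold Rdiv. rewrite Rmult_assoc, Rinv_l, Rmult_1_r by lra.
assert (d ^ 2 / 2 <= (d - e) * (d + e)) by nra. nra.
Qed.

(** * Recursive tests for certificates *)

Definition qhalfpow (n : nat) : nat := qinv (qnat (2 ^ n)).
Definition qodds (w : nat) : nat := qmul w (qinv (qsub (qnat 1) w)).
Definition qlabel (y p : nat) : nat :=
  qadd (qmul (qnat y) p) (qmul (qnat (1 - y)) (qsub (qnat 1) p)).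

Lemma rec1_qhalfpow : rec1 qhalfpow.
Proof. unfold qhalfpow. rec_tac. Qed.
Lemma rec1_qodds : rec1 qodds.
Proof. unfold qodds. rec_tac. Qed.
Lemma rec2_qlabel : rec2 qlabel.
Proof. unfold qlabel. rec_tac. Qed.
#[local] Hint Resolve rec1_qhalfpow rec1_qodds rec2_qlabel : rec.

Lemma qR_qhalfpow n : qR (qhalfpow n) = / 2 ^ n.
Proof.
assert (INR (2 ^ n) = 2 ^ n) as E by (rewrite pow_INR; reflexivity).
unfold qhalfpow. rewrite qR_qinv; rewrite qR_qnat, E; [reflexivity|]. apply pow_lt. lra.
Qed.

Lemma qR_qodds w : qR w < 1 -> qR (qodds w) = odds (qR w).
Proof.
intros h. unfold qodds, odds. rewrite qR_qmul, qR_qinv; rewrite qR_qsub, qR_qnat; simpl; lra.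
Qed.

Lemma qR_qlabel (y : bool) p : qR (qlabel (Nat.b2n y) p) = if y then qR p else 1 - qR p.
Proof.
unfold qlabel. rewrite qR_qadd, !qR_qmul, qR_qsub, !qR_qnat. destruct y; simpl; ring.
Qed.

(* A certificate [c] holds a precision [n] for the inputs, a mesh [1/N], and bounds
   [i/N <= - ln p <= j/N]; [leak] is zero when the bounds can be verified from
   the approximations at precision [n] and are accurate up to [2^-t]. *)
Definition cert_prec (c : nat) : nat := unfst c.
Definition cert_mesh (c : nat) : nat := qinv (qnat (S (unfst (unsnd c)))).
Definition cert_lower (c : nat) : nat := unfst (unsnd (unsnd c)).
Definition cert_upper (c : nat) : nat := unsnd (unsnd (unsnd c)).

(** The summands test the upper bound, the lower bound and the width. The factor [cert_lower c]
    waives the second test for a zero lower bound. *)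
Definition log_leak (c p t : nat) : nat :=
  qgt (qnat 1) (qmul (qsub p (qhalfpow (cert_prec c)))
                  (qpow (qadd (qnat 1) (cert_mesh c)) (cert_upper c)))
  + cert_lower c * qgt (qadd p (qhalfpow (cert_prec c)))
                     (qpow (qsub (qnat 1) (cert_mesh c)) (cert_lower c))
  + qgt (qmul (qsub (qnat (cert_upper c)) (qnat (cert_lower c))) (cert_mesh c)) (qhalfpow t).

(** The first summand vanishes when w + 2^-n < 1, which keeps [qodds] off its pole at 1; the second
    bounds the spread of the odds. *)
Definition lam_leak (n w t : nat) : nat :=
  (1 - qgt (qnat 1) (qadd w (qhalfpow n)))
  + qgt (qsub (qodds (qadd w (qhalfpow n))) (qodds (qsub w (qhalfpow n)))) (qhalfpow t).

Definition leak (c p w t : nat) : nat := log_leak c p t + lam_leak (cert_prec c) w t.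

Lemma leak_eq0 c p w t :
  leak c p w t = 0%nat <-> log_leak c p t = 0%nat /\ lam_leak (cert_prec c) w t = 0%nat.
Proof. unfold leak. apply Nat.eq_add_0. Qed.

(** The log loss enters at its upper end and lam at its lower end, so that the error is upward. *)
Definition increment (M c w : nat) : nat :=
  qsub (qmul (qnat M) (qmul (qnat (cert_upper c)) (cert_mesh c)))
       (qodds (qsub w (qhalfpow (cert_prec c)))).

Lemma rec1_cert_prec : rec1 cert_prec.
Proof. unfold cert_prec. rec_tac. Qed.
Lemma rec1_cert_mesh : rec1 cert_mesh.
Proof. unfold cert_mesh. rec_tac. Qed.
Lemma rec1_cert_lower : rec1 cert_lower.
Proof. unfold cert_lower. rec_tac. Qed.
Lemma rec1_cert_upper : rec1 cert_upper.
Proof. unfold cert_upper. rec_tac. Qed.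
#[local] Hint Resolve rec1_cert_prec rec1_cert_mesh rec1_cert_lower rec1_cert_upper : rec.
Lemma rec3_log_leak : rec3 log_leak.
Proof. unfold log_leak. rec_tac. Qed.
Lemma rec3_lam_leak : rec3 lam_leak.
Proof. unfold lam_leak. rec_tac. Qed.
#[local] Hint Resolve rec3_log_leak rec3_lam_leak : rec.
Lemma rec2_increment M : rec2 (increment M).
Proof. unfold increment. rec_tac. Qed.

Lemma INR_S_gt0 n : 0 < INR (S n).
Proof. apply lt_0_INR. lia. Qed.

Lemma qR_cert_mesh c : qR (cert_mesh c) = / INR (S (unfst (unsnd c))).
Proof.
unfold cert_mesh. rewrite qR_qinv; rewrite qR_qnat; [reflexivity|apply INR_S_gt0].
Qed.

Lemma Rabs_le_between x y e : Rabs (x - y) <= e -> x - e <= y <= x + e.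
Proof. pose proof (Rle_abs (x - y)). pose proof (Rle_abs (- (x - y))) as h.
rewrite Rabs_Ropp in h. lra. Qed.

Lemma log_leak_sound c q t p :
  log_leak c q t = 0%nat -> p <= 1 -> Rabs (qR q - p) <= / 2 ^ cert_prec c ->
  0 < p /\ - ln p <= qR (qmul (qnat (cert_upper c)) (cert_mesh c)) <= - ln p + / 2 ^ t.
Proof.
unfold log_leak. intros h hp1 happ. apply Rabs_le_between in happ.
apply Nat.eq_add_0 in h as [h h3]. apply Nat.eq_add_0 in h as [h1 h2].
apply qgt_eq0 in h1, h3.
rewrite ?qR_qmul, ?qR_qpow, ?qR_qsub, ?qR_qadd, ?qR_qhalfpow, ?qR_cert_mesh, ?qR_qnat in *.
pose proof (INR_S_gt0 (unfst (unsnd c))) as hN.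
assert (1 <= INR (S (unfst (unsnd c)))) as hN1
  by (rewrite S_INR; pose proof (pos_INR (unfst (unsnd c))); lra).
set (N := INR (S (unfst (unsnd c)))) in *. simpl (INR 1) in *.
destruct (log_upper_cert (qR q - / 2 ^ cert_prec c) p N (cert_upper c)) as [hp hu]; [lra..|].
split; [exact hp|].
assert (INR (cert_lower c) / N <= - ln p) as hl.
{ apply (log_lower_cert (qR q + / 2 ^ cert_prec c)); [lra..|].
  apply Nat.eq_mul_0 in h2 as [h2|h2]; [now left|right]. apply qgt_eq0 in h2.
  rewrite ?qR_qmul, ?qR_qpow, ?qR_qsub, ?qR_qadd, ?qR_qhalfpow, ?qR_cert_mesh, ?qR_qnat in h2.
  exact h2. }
unfold Rdiv in *. lra.
Qed.

Lemma lam_leak_sound n w t v :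
  lam_leak n w t = 0%nat -> 0 <= v -> Rabs (qR w - v / (1 + v)) <= / 2 ^ n ->
  v - / 2 ^ t <= qR (qodds (qsub w (qhalfpow n))) <= v.
Proof.
unfold lam_leak. intros h hv happ. apply Rabs_le_between in happ.
apply Nat.eq_add_0 in h as [h1 h2]. apply qgt_eq0 in h2.
assert (qR (qadd w (qhalfpow n)) < 1) as hw.
{ apply Rnot_le_lt. intros hle. replace 1 with (qR (qnat 1)) in hle by apply qR_qnat.
  apply qgt_eq0 in hle. rewrite hle in h1. discriminate. }
pose proof (pow2_inv_gt0 n) as he.
rewrite qR_qadd, qR_qhalfpow in hw.
rewrite qR_qsub, !qR_qodds, !qR_qsub, !qR_qadd, !qR_qhalfpow in h2;
  rewrite ?qR_qsub, ?qR_qadd, ?qR_qhalfpow; try lra.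
rewrite qR_qodds; rewrite qR_qsub, qR_qhalfpow; [|lra].
pose proof (odds_incr (qR w - / 2 ^ n) (v / (1 + v))) as o1.
pose proof (odds_incr (v / (1 + v)) (qR w + / 2 ^ n)) as o2.
rewrite (odds_squash v hv) in *. lra.
Qed.

(** Mesh and bounds are chosen before the precision, which may then grow to suit the other loss as
    well. *)
Lemma log_leak_complete p t : 0 < p <= 1 ->
  exists d n0, forall n q, (n0 <= n)%nat -> Rabs (qR q - p) <= / 2 ^ n ->
    log_leak (pairN n d) q t = 0%nat.
Proof.
intros hp.
destruct (log_cert_exists p (/ 2 ^ t) hp (pow2_inv_gt0 t)) as (N & i & j & h1 & h2 & h3).
pose proof (INR_S_gt0 N) as hN.
assert (/ INR (S N) <= 1) as hN1.
{ rewrite <- Rinv_1. apply Rinv_le_contravar; [lra|]. rewrite S_INR.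
  pose proof (pos_INR N). lra. }
pose proof (Rinv_0_lt_compat _ hN) as hi.
set (A := (1 + / INR (S N)) ^ j) in *.
assert (0 < A) as hA by (apply pow_lt; lra).
(* The tested lower bound may lie 2 * 2^-n below p, and (p - 2 * 2^-n) A must still reach 1. *)
destruct (pow2_inv_small ((p * A - 1) / (2 * A))) as [n1 H1].
{ apply Rdiv_lt_0_compat; lra. }
assert (exists n2, forall n, (n2 <= n)%nat ->
  i = 0%nat \/ p + 2 * / 2 ^ n <= (1 - / INR (S N)) ^ i) as [n2 H2].
{ destruct h2 as [->|h2]; [exists 0%nat; now left|].
  destruct (pow2_inv_small (((1 - / INR (S N)) ^ i - p) / 2)) as [n2 H2]; [lra|].
  exists n2. intros n hn. right. specialize (H2 n hn). lra. }
exists (pairN N (pairN i j)), (Nat.max n1 n2). intros n q hn happ.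
apply Rabs_le_between in happ.
specialize (H1 n ltac:(lia)). specialize (H2 n ltac:(lia)).
unfold log_leak, cert_prec, cert_lower, cert_upper.
rewrite !unsnd_pairN, !unfst_pairN.
assert (qR (cert_mesh (pairN n (pairN N (pairN i j)))) = / INR (S N)) as Em
  by now rewrite qR_cert_mesh, unsnd_pairN, unfst_pairN.
set (m := cert_mesh _) in *.
apply Nat.eq_add_0; split; [apply Nat.eq_add_0; split|].
- apply qgt_eq0.
  rewrite ?qR_qmul, ?qR_qpow, ?qR_qsub, ?qR_qadd, ?qR_qhalfpow, ?Em, ?qR_qnat.
  simpl (INR 1). fold A.
  apply Rmult_le_compat_r with (r := 2 * A) in H1; [|lra].
  unfold Rdiv in H1. rewrite Rmult_assoc, Rinv_l in H1 by lra. nra.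
- destruct H2 as [->|H2]; [reflexivity|].
  apply Nat.eq_mul_0. right. apply qgt_eq0.
  rewrite ?qR_qmul, ?qR_qpow, ?qR_qsub, ?qR_qadd, ?qR_qhalfpow, ?Em, ?qR_qnat.
  simpl (INR 1). lra.
- apply qgt_eq0.
  now rewrite ?qR_qmul, ?qR_qpow, ?qR_qsub, ?qR_qadd, ?qR_qhalfpow, ?Em, ?qR_qnat.
Qed.

Lemma lam_leak_complete v t : 0 <= v ->
  exists n0, forall n w, (n0 <= n)%nat -> Rabs (qR w - v / (1 + v)) <= / 2 ^ n ->
    lam_leak n w t = 0%nat.
Proof.
intros hv.
assert (v / (1 + v) < 1) as hx.
{ apply Rmult_lt_reg_r with (1 + v); [lra|]. unfold Rdiv.
  rewrite Rmult_assoc, Rinv_l; lra. }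
destruct (odds_continuous _ (/ 2 ^ t) hx (pow2_inv_gt0 t)) as (eps & heps & H).
destruct (pow2_inv_small (eps / 2)) as [n0 H0]; [lra|].
exists n0. intros n w hn happ. apply Rabs_le_between in happ. specialize (H0 n hn).
pose proof (pow2_inv_gt0 n) as he.
destruct (H (2 * / 2 ^ n)) as [ha hb]; [lra|].
assert (qR (qadd w (qhalfpow n)) < 1) as hw by (rewrite qR_qadd, qR_qhalfpow; lra).
unfold lam_leak. apply Nat.eq_add_0; split.
- enough (qgt (qnat 1) (qadd w (qhalfpow n)) <> 0%nat) by lia.
  rewrite qgt_eq0, qR_qnat. simpl. lra.
- apply qgt_eq0.
  rewrite qR_qsub, !qR_qodds, !qR_qsub, !qR_qadd, !qR_qhalfpow;
    rewrite ?qR_qsub, ?qR_qadd, ?qR_qhalfpow in *; try lra.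
  set (x := v / (1 + v)) in *.
  pose proof (odds_incr (qR w + / 2 ^ n) (x + 2 * / 2 ^ n)) as o1.
  pose proof (odds_incr (x - 2 * / 2 ^ n) (qR w - / 2 ^ n)) as o2. lra.
Qed.

(** * The tangent inequality *)

Definition pr (y : bool) (p : R) : R := if y then p else 1 - p.

Lemma loss_ge0 lam y p : loss_function lam -> 0 <= p <= 1 -> Rbar_le (Finite 0) (lam y p).
Proof.
intros (_ & h0 & h1 & hi & hd & _) hp. destruct y.
- rewrite <- h1. apply hd; lra.
- rewrite <- h0. apply hi; lra.
Qed.

(** The only endpoint giving the label positive probability is the one where its loss is 0. *)
Lemma loss_finite lam y p : loss_function lam -> 0 <= p <= 1 -> 0 < pr y p ->
  exists v, lam y p = Finite v /\ 0 <= v.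
Proof.
intros hl hp hy. pose proof (loss_ge0 lam y p hl hp) as hge.
destruct hl as (_ & h0 & h1 & _ & _ & hfin).
destruct (Req_dec p (if y then 1 else 0)) as [->|hne].
- exists 0. split; [now destruct y|lra].
- assert (0 < p < 1) as hin by (destruct y; simpl in hy; lra).
  rewrite <- (hfin y p hin) in *. now exists (real (lam y p)).
Qed.

Lemma expneg_ge0 eta x : 0 <= expneg eta x.
Proof. destruct x; simpl; [apply Rlt_le, exp_pos|lra|lra]. Qed.

Lemma expneg_le1 eta x : 0 < eta -> Rbar_le (Finite 0) x -> expneg eta x <= 1.
Proof.
intros he hx. destruct x as [r| |]; simpl in *; [|lra|lra].
rewrite <- exp_0. apply Rnot_lt_le. intros h. apply exp_lt_inv in h. nra.
Qed.

Lemma expneg_gt0 eta x : Rbar_le (Finite 0) x -> 0 < expneg eta x -> is_finite x.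
Proof. destruct x; simpl; intros h1 h2; [reflexivity|lra|easy]. Qed.

Lemma le_expneg_ln eta u r : 0 < u -> u <= expneg eta (Finite r) -> eta * r <= - ln u.
Proof.
intros hu h. simpl in h. apply ln_le in h; [|exact hu]. rewrite ln_exp in h. lra.
Qed.

(** Explicit substitute for the derivative of ln at 1, through ln (1 + x) >= x / (1 + x); here 1 + x
    >= 1 / 2 gives the constant 2. *)
Lemma ln_ge_quadratic x : Rabs x <= 1 / 2 -> x - 2 * x ^ 2 <= ln (1 + x).
Proof.
intros h. assert (- (1 / 2) <= x <= 1 / 2) as hx.
{ pose proof (Rabs_le_between x 0 (1 / 2)) as hb. rewrite Rminus_0_r in hb.
  specialize (hb h). lra. }
pose proof (exp_ineq1_le (- ln (1 + x))) as he. rewrite exp_Ropp, exp_ln in he by lra.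
assert (/ (1 + x) = 1 - x / (1 + x)) as E by (field; lra).
apply Rle_trans with (x / (1 + x)); [|lra].
apply Rmult_le_reg_r with (1 + x); [lra|].
unfold Rdiv. rewrite Rmult_assoc, Rinv_l by lra. nra.
Qed.

Lemma expected_loss_finite lam p q a b : lam true q = Finite a -> lam false q = Finite b ->
  expected_loss lam p q = Finite (p * a + (1 - p) * b).
Proof. unfold expected_loss. now intros -> ->. Qed.

(* Properness makes [p0] the minimizer of the expected loss; along the segment from the
   point of [p0] to that of [p], which stays in the convex set, the right derivative of
   the expected loss at the start is the left-hand side minus one, up to a negative factor. *)
Lemma mixable_proper_tangent lam eta p0 p :
  loss_function lam -> proper lam -> 0 < eta -> eta_mixable lam eta ->
  0 < p0 < 1 -> 0 <= p <= 1 ->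
  (1 - p0) * (expneg eta (lam false p) / expneg eta (lam false p0))
  + p0 * (expneg eta (lam true p) / expneg eta (lam true p0)) <= 1.
Proof.
intros hl hprop heta hmix hp0 hp.
destruct (loss_finite lam false p0 hl) as (r0 & E0 & hr0); [lra|simpl; lra|].
destruct (loss_finite lam true p0 hl) as (r1 & E1 & hr1); [lra|simpl; lra|].
set (u0 := expneg eta (lam false p0)). set (v0 := expneg eta (lam true p0)).
set (u := expneg eta (lam false p)). set (v := expneg eta (lam true p)).
assert (0 < u0 <= 1) as hu0.
{ split; [unfold u0; rewrite E0; apply exp_pos|]. apply expneg_le1, loss_ge0; trivial; lra. }
assert (0 < v0 <= 1) as hv0.
{ split; [unfold v0; rewrite E1; apply exp_pos|]. apply expneg_le1, loss_ge0; trivial; lra. }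
assert (0 <= u <= 1) as hu.
{ split; [apply expneg_ge0|]. now apply expneg_le1, loss_ge0. }
assert (0 <= v <= 1) as hv.
{ split; [apply expneg_ge0|]. now apply expneg_le1, loss_ge0. }
set (a := u / u0 - 1). set (b := v / v0 - 1).
assert (u = u0 * (1 + a)) as Eu by (unfold a; field; lra).
assert (v = v0 * (1 + b)) as Ev by (unfold b; field; lra).
assert (- 1 <= a /\ - 1 <= b) as [ha hb].
{ assert (0 < / u0) by (apply Rinv_0_lt_compat; lra).
  assert (0 < / v0) by (apply Rinv_0_lt_compat; lra).
  unfold a, b, Rdiv. split; nra. }
(* The mixture is dominated by the point of some q, and properness compares q with p0. Excluding t =
   1 keeps the logarithms defined when p has an infinite loss, where a or b is -1. *)
assert (forall t, 0 <= t < 1 -> (1 - p0) * ln (1 + t * a) + p0 * ln (1 + t * b) <= 0) as hdir.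
{ intros t ht.
  assert (0 < 1 + t * a) as hta by nra. assert (0 < 1 + t * b) as htb by nra.
  destruct (hmix u v u0 v0 t) as (_ & _ & q & hq & hqu & hqv).
  - split; [lra|split; [lra|]]. exists p. split; [lra|]. split; apply Rle_refl.
  - split; [lra|split; [lra|]]. exists p0. split; [lra|]. split; apply Rle_refl.
  - lra.
  - replace (t * u + (1 - t) * u0) with (u0 * (1 + t * a)) in hqu by (rewrite Eu; ring).
    replace (t * v + (1 - t) * v0) with (v0 * (1 + t * b)) in hqv by (rewrite Ev; ring).
    assert (0 < u0 * (1 + t * a)) as hpu by (apply Rmult_lt_0_compat; lra).
    assert (0 < v0 * (1 + t * b)) as hpv by (apply Rmult_lt_0_compat; lra).
    pose proof (expneg_gt0 eta _ (loss_ge0 lam false q hl hq) (Rlt_le_trans _ _ _ hpu hqu)) as F0.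
    pose proof (expneg_gt0 eta _ (loss_ge0 lam true q hl hq) (Rlt_le_trans _ _ _ hpv hqv)) as F1.
    rewrite <- F0 in hqu. rewrite <- F1 in hqv.
    apply le_expneg_ln in hqu; [|exact hpu]. apply le_expneg_ln in hqv; [|exact hpv].
    rewrite ln_mult in hqu, hqv by lra.
    assert (ln u0 = - (eta * r0)) as Lu by (unfold u0; rewrite E0; apply ln_exp).
    assert (ln v0 = - (eta * r1)) as Lv by (unfold v0; rewrite E1; apply ln_exp).
    pose proof (hprop p0 q ltac:(lra) hq) as hpr.
    rewrite (expected_loss_finite lam p0 p0 _ _ E1 E0) in hpr.
    rewrite (expected_loss_finite lam p0 q _ _ (eq_sym F1) (eq_sym F0)) in hpr.
    simpl in hpr. rewrite Lu in hqu. rewrite Lv in hqv.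
    set (s0 := real (lam false q)) in *. set (s1 := real (lam true q)) in *.
    apply Rmult_le_compat_l with (r := eta) in hpr; [|lra].
    apply Rmult_le_compat_l with (r := 1 - p0) in hqu; [|lra].
    apply Rmult_le_compat_l with (r := p0) in hqv; [|lra]. lra. }
assert (u / u0 = 1 + a) as -> by (unfold a; ring).
assert (v / v0 = 1 + b) as -> by (unfold b; ring).
enough ((1 - p0) * a + p0 * b <= 0) by lra.
apply Rnot_lt_le. intros hS. set (S := (1 - p0) * a + p0 * b) in *.
set (K := 1 + Rabs a + Rabs b).
pose proof (Rabs_pos a) as hA. pose proof (Rabs_pos b) as hB.
(* The first bound admits [ln_ge_quadratic]; the second makes the quadratic error at most half of t
   S, which leaves a positive value against [hdir]. *)
set (t := Rmin (/ (2 * K)) (S / (4 * K ^ 2))).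
assert (0 < K) as hK by (unfold K; lra).
assert (0 < K ^ 2) as hK2 by (apply pow_lt; lra).
assert (0 < t) as ht.
{ apply Rmin_pos; [apply Rinv_0_lt_compat; lra|]. apply Rdiv_lt_0_compat; lra. }
assert (t * K <= 1 / 2) as ht1.
{ apply Rle_trans with (/ (2 * K) * K); [apply Rmult_le_compat_r, Rmin_l; lra|].
  right. field. lra. }
assert (4 * t * K ^ 2 <= S) as ht2.
{ apply Rle_trans with (4 * (S / (4 * K ^ 2)) * K ^ 2).
  - apply Rmult_le_compat_r; [lra|]. apply Rmult_le_compat_l; [lra|apply Rmin_r].
  - right. field. lra. }
assert (t < 1) as ht3 by (unfold K in ht1; nra).
assert (forall x, Rabs x <= K -> t * x - 2 * t ^ 2 * K ^ 2 <= ln (1 + t * x)) as hq.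
{ intros x hx. eapply Rle_trans; [|apply ln_ge_quadratic].
  - assert (x ^ 2 <= K ^ 2)
      by (rewrite <- (pow2_abs x); apply pow_incr; split; [apply Rabs_pos|exact hx]).
    assert (0 <= t ^ 2) by (apply pow2_ge_0). nra.
  - rewrite Rabs_mult, (Rabs_pos_eq t) by lra. nra. }
pose proof (hq a ltac:(unfold K; lra)) as qa. pose proof (hq b ltac:(unfold K; lra)) as qb.
specialize (hdir t ltac:(lra)).
assert (t * S - 2 * t ^ 2 * K ^ 2 <= 0) as hfin by (unfold S; nra).
assert (0 < t * S) as htS by (apply Rmult_lt_0_compat; assumption).
assert (2 * t ^ 2 * K ^ 2 <= t * S / 2) by nra. lra.
Qed.

(** The tangent to exp at a z is evaluated at z and at 0; with weights a and 1 - a the linear terms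
    cancel. *)
Lemma exp_convex a z : 0 <= a <= 1 -> exp (a * z) <= 1 + a * (exp z - 1).
Proof.
intros ha. pose proof (exp_pos (a * z)) as hm.
assert (exp (a * z) * (1 + (z - a * z)) <= exp z) as h1.
{ replace (exp z) with (exp (a * z) * exp (z - a * z)) by (rewrite <- exp_plus; f_equal; ring).
  apply Rmult_le_compat_l; [lra|apply exp_ineq1_le]. }
assert (exp (a * z) * (1 + - (a * z)) <= 1) as h2.
{ replace 1 with (exp (a * z) * exp (- (a * z))) at 2
    by (rewrite <- exp_plus, <- exp_0; f_equal; ring).
  apply Rmult_le_compat_l; [lra|apply exp_ineq1_le]. }
apply Rmult_le_compat_l with (r := a) in h1; [|lra].
apply Rmult_le_compat_l with (r := 1 - a) in h2; [|lra]. lra.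
Qed.

(* [q] is the prediction [p0] tilted by [exp ((lam y p0 - lam y p) / M)]. *)
Lemma log_loss_tilting lam : loss_function lam -> proper lam -> mixable lam ->
  exists M : nat, (0 < M)%nat /\ forall p0 p, 0 <= p0 <= 1 -> 0 <= p <= 1 ->
  exists q, 0 <= q <= 1 /\ forall y v a, 0 < pr y p0 -> lam y p0 = Finite v ->
    lam y p = Finite a ->
    0 < pr y q /\ - ln (pr y q) <= - ln (pr y p0) + (a - v) / INR M.
Proof.
intros hl hprop (eta & heta & hmix).
destruct (nat_floor (/ eta)) as [m hm]; [now apply Rlt_le, Rinv_0_lt_compat|].
exists (S m). split; [lia|]. set (M := INR (S m)).
assert (/ eta < M) as hM by (unfold M; rewrite S_INR; lra).
pose proof (Rinv_0_lt_compat _ heta) as hie.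
set (c := / M / eta).
assert (0 < / M) as hiM by (apply Rinv_0_lt_compat; lra).
assert (0 < c <= 1) as hc.
{ split; [now apply Rdiv_lt_0_compat|].
  unfold c, Rdiv. apply Rmult_le_reg_l with M; [lra|].
  rewrite <- Rmult_assoc, Rinv_r; lra. }
intros p0 p hp0 hp.
(* The default 0 is sound: an infinite loss of p receives no mass, and p0 has an infinite loss only
   at a label of probability 0. *)
set (w := fun y => match lam y p, lam y p0 with
                   | Finite a, Finite v => exp ((v - a) / M)
                   | _, _ => 0 end).
assert (forall y, 0 <= w y) as hw.
{ intros y. unfold w. destruct (lam y p), (lam y p0); try lra. apply Rlt_le, exp_pos. }
assert (pr false p0 * w false + pr true p0 * w true <= 1) as hsum.
(* The tangent inequality is confined to 0 < p0 < 1. At an endpoint, the certain label has loss 0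
   under p0 and cannot gain weight, while the other label has no mass. *)
{ assert (forall y, pr y p0 = 1 -> w y <= 1) as hcert.
  { intros y hy. destruct (loss_finite lam y p0 hl hp0) as (v & E & _); [lra|].
    assert (v = 0) as ->.
    { destruct hl as (_ & h0 & h1 & _). destruct y; simpl in hy.
      - subst p0. congruence.
      - replace p0 with 0 in E by lra. congruence. }
    pose proof (loss_ge0 lam y p hl hp) as hge.
    unfold w. rewrite E. destruct (lam y p) as [a| |]; try lra. simpl in hge.
    rewrite <- exp_0. apply Rnot_lt_le. intros h. apply exp_lt_inv in h.
    unfold Rdiv in h. nra. }
  destruct (Req_dec p0 0) as [h0|h0].
  { specialize (hcert false ltac:(simpl; lra)). simpl. rewrite h0. lra. }
  destruct (Req_dec p0 1) as [h1|h1].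
  { specialize (hcert true ltac:(simpl; lra)). simpl. rewrite h1. lra. }
  pose proof (mixable_proper_tangent lam eta p0 p hl hprop heta hmix ltac:(lra) hp) as htan.
  assert (forall y, 0 < pr y p0 ->
    w y <= 1 + c * (expneg eta (lam y p) / expneg eta (lam y p0) - 1)) as hb.
  { intros y hy. destruct (loss_finite lam y p0 hl hp0 hy) as (v & E & _).
    unfold w. rewrite E. destruct (lam y p) as [a| |] eqn:Ea.
    - replace ((v - a) / M) with (c * (eta * (v - a))) by (unfold c; field; lra).
      replace (expneg eta (Finite a) / expneg eta (Finite v)) with (exp (eta * (v - a))).
      + apply exp_convex. lra.
      + simpl. unfold Rdiv. rewrite <- exp_Ropp, <- exp_plus. f_equal. ring.
    - simpl (expneg eta p_infty). unfold Rdiv. rewrite Rmult_0_l. lra.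
    - destruct hl as [hl _]. now destruct (hl y p). }
  pose proof (hb true ltac:(simpl; lra)) as b1. pose proof (hb false ltac:(simpl; lra)) as b0.
  simpl. apply Rmult_le_compat_l with (r := p0) in b1; [|lra].
  apply Rmult_le_compat_l with (r := 1 - p0) in b0; [|lra].
  apply Rmult_le_compat_l with (r := c) in htan; [|lra]. lra. }
simpl pr in hsum. pose proof (hw true) as w1. pose proof (hw false) as w0.
(* Mass missing from the total goes to the label 0, which only lowers its log loss. *)
exists (p0 * w true). split; [nra|].
intros y v a hy Ev Ea.
assert (w y = exp ((v - a) / M)) as Ew by (unfold w; now rewrite Ea, Ev).
assert (0 < pr y p0 * w y) as hpos.
{ rewrite Ew. apply Rmult_lt_0_compat; [exact hy|apply exp_pos]. }
assert (pr y p0 * w y <= pr y (p0 * w true)) as hle by (destruct y; simpl in *; lra).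
split; [lra|].
apply ln_le in hle; [|exact hpos].
rewrite ln_mult, Ew, ln_exp in hle; [|exact hy|rewrite Ew; apply exp_pos].
unfold Rdiv in *. lra.
Qed.

(** * Superloss processes *)

Lemma log_loss_eq y p : 0 < pr y p -> log_loss y p = Finite (- ln (pr y p)).
Proof.
unfold log_loss. destruct y; simpl; intros h; [destruct Rlt_dec|destruct Rlt_dec]; trivial; lra.
Qed.

Lemma log_loss_infty y p : ~ 0 < pr y p -> log_loss y p = p_infty.
Proof.
unfold log_loss. destruct y; simpl; intros h; [destruct Rlt_dec|destruct Rlt_dec]; trivial; lra.
Qed.

Lemma least_zero (f : nat -> nat) : (exists c, f c = 0%nat) ->
  exists c, f c = 0%nat /\ forall m, (m < c)%nat -> exists w, f m = S w.
Proof.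
intros [c hc]. induction c as [c IH] using lt_wf_ind.
destruct (classic (exists m, (m < c)%nat /\ f m = 0%nat)) as [(m & hm & hf)|hn].
- exact (IH m hm hf).
- exists c. split; [exact hc|]. intros m hm. destruct (f m) as [|w] eqn:E; [|now exists w].
  exfalso. apply hn. now exists m.
Qed.

Section Processes.
Context {k : nat}.
Implicit Types (s u : list (Zt k)) (x : Obj k) (y : bool).

Lemma prediction_approx (F : list (Zt k) -> Obj k -> R) : prediction_algorithm F ->
  exists e (g : list (Zt k) -> Obj k -> nat -> nat), forall s x,
    (forall n, eval no_oracle e [n; encS s; proj1_sig x] (g s x n)) /\ name_of (g s x) (F s x).
Proof.
intros [_ [e He]]. exists e.
exists (fun s x n => proj1_sig (constructive_indefinite_description _ (He s x n))).
intros s x. split; intros n; now destruct constructive_indefinite_description.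
Qed.

(** The program of F is itself a name of the prediction, so it can replace the oracle, with history
    and object as the two carried parameters. *)
Lemma loss_approx lam (F : list (Zt k) -> Obj k -> R) :
  computable_loss lam -> prediction_algorithm F ->
  exists e (g : list (Zt k) -> Obj k -> bool -> nat -> nat), forall s x y n,
    eval no_oracle e [n; Nat.b2n y; encS s; proj1_sig x] (g s x y n) /\
    Rabs (qR (g s x y n) - squash (lam y (F s x))) <= / 2 ^ n.
Proof.
intros [e He] HF. destruct (prediction_approx F HF) as (eF & gF & HgF).
assert (forall s x y n, exists m, eval (gF s x) e [n; Nat.b2n y] m /\
  Rabs (qR m - squash (lam y (F s x))) <= / 2 ^ n) as H.
{ intros s x y n. apply He; [apply HF|apply HgF]. }
exists (subst_oracle eF e 2).
exists (fun s x y n => proj1_sig (constructive_indefinite_description _ (H s x y n))).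
intros s x y n. destruct constructive_indefinite_description as [m [Hm Ha]]. split; [|exact Ha].
apply (eval_subst_oracle (gF s x) eF (encS s) (proj1_sig x) e [n; Nat.b2n y]); [|exact Hm].
apply HgF.
Qed.

(** The recursion over steps keeps the whole sequence as a parameter, so each step extracts its own
    past, object and label. The first argument is the candidate certificate of the search. *)
Lemma step_data_code : exists e1 e2 e3, forall s x y u c,
  eval no_oracle e1 [c; length s; encS (s ++ (x, y) :: u)] (encS s) /\
  eval no_oracle e2 [c; length s; encS (s ++ (x, y) :: u)] (proj1_sig x) /\
  eval no_oracle e3 [c; length s; encS (s ++ (x, y) :: u)] (Nat.b2n y).
Proof.
assert (rec 3 (fun xs => firstn_code (nth 1 xs 0%nat) (nth 2 xs 0%nat))) as [e1 H1] by rec_tac.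
assert (rec 3 (fun xs => unfst (nth_code (nth 1 xs 0%nat) (nth 2 xs 0%nat)))) as [e2 H2] by rec_tac.
assert (rec 3 (fun xs => unsnd (nth_code (nth 1 xs 0%nat) (nth 2 xs 0%nat)))) as [e3 H3] by rec_tac.
exists e1, e2, e3. intros s x y u c. set (xs := [c; length s; encS (s ++ (x, y) :: u)]).
specialize (H1 xs eq_refl). specialize (H2 xs eq_refl). specialize (H3 xs eq_refl).
cbn [xs nth] in H1, H2, H3. rewrite firstn_code_encS in H1.
rewrite nth_code_encS in H2, H3.
rewrite unfst_pairN in H2. rewrite unsnd_pairN in H3. now repeat split.
Qed.

(** The value [b s x y] is independent of the continuation u, because the search sees only the past,
    the object and the label. *)
Lemma increment_code lam F (M : nat) :
  loss_function lam -> computable_loss lam -> prediction_algorithm F ->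
  exists e (b : list (Zt k) -> Obj k -> bool -> nat), forall s x y,
    (forall u v, eval no_oracle e [length s; encS (s ++ (x, y) :: u)] v -> 0 < pr y (F s x)) /\
    (0 < pr y (F s x) ->
      (forall u, eval no_oracle e [length s; encS (s ++ (x, y) :: u)] (b s x y)) /\
      forall a, lam y (F s x) = Finite a ->
        INR M * - ln (pr y (F s x)) - a <= qR (b s x y)
          <= INR M * - ln (pr y (F s x)) - a + (INR M + 1) * / 2 ^ length s).
Proof.
intros hl hc hF.
destruct (prediction_approx F hF) as (eF & gF & HgF).
destruct (loss_approx lam F hc hF) as (eL & gL & HgL).
set (p := fun s x y c => qlabel (Nat.b2n y) (gF s x (cert_prec c))).
set (w := fun s x y c => gL s x y (cert_prec c)).
set (lk := fun s x y c => leak c (p s x y c) (w s x y c) (length s)).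
assert (forall s x y c, Rabs (qR (p s x y c) - pr y (F s x)) <= / 2 ^ cert_prec c) as Hp.
{ intros s x y c. destruct (HgF s x) as [_ Hn]. specialize (Hn (cert_prec c)).
  unfold p. rewrite qR_qlabel. destruct y; simpl; [exact Hn|].
  rewrite <- Rabs_Ropp. eapply Rle_trans; [right|exact Hn]. f_equal. ring. }
assert (forall s x y c a, lam y (F s x) = Finite a -> 0 <= a ->
  Rabs (qR (w s x y c) - a / (1 + a)) <= / 2 ^ cert_prec c) as Hw.
{ intros s x y c a E ha. destruct (HgL s x y (cert_prec c)) as [_ Hn].
  rewrite E in Hn. simpl in Hn. rewrite (Rabs_pos_eq a ha) in Hn. exact Hn. }
destruct step_data_code as (e1 & e2 & e3 & Hdata).
assert (rec 3 (fun xs => cert_prec (nth 0 xs 0%nat))) as [e4 He4] by rec_tac.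
assert (exists e, forall s x y u c,
  eval no_oracle e [c; length s; encS (s ++ (x, y) :: u)] (p s x y c)) as [ep Hep].
{ destruct rec2_qlabel as [eq Heq]. exists (CComp eq [e3; CComp eF [e4; e1; e2]]).
  intros s x y u c. destruct (Hdata s x y u c) as (h1 & h2 & h3).
  specialize (He4 [c; length s; encS (s ++ (x, y) :: u)] eq_refl).
  destruct (HgF s x) as [HF _].
  apply ev_comp with [Nat.b2n y; gF s x (cert_prec c)]; [|apply Heq].
  constructor; [exact h3|]. constructor; [|constructor].
  apply ev_comp with [cert_prec c; encS s; proj1_sig x]; [|apply HF].
  now repeat constructor. }
assert (exists e, forall s x y u c,
  eval no_oracle e [c; length s; encS (s ++ (x, y) :: u)] (w s x y c)) as [ew Hew].
{ exists (CComp eL [e4; e3; e1; e2]).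
  intros s x y u c. destruct (Hdata s x y u c) as (h1 & h2 & h3).
  specialize (He4 [c; length s; encS (s ++ (x, y) :: u)] eq_refl).
  apply ev_comp with [cert_prec c; Nat.b2n y; encS s; proj1_sig x]; [|apply HgL].
  now repeat constructor. }
assert (exists e, forall s x y u c,
  eval no_oracle e [c; length s; encS (s ++ (x, y) :: u)] (lk s x y c)) as [elk Helk].
{ assert (rec 4 (fun xs => leak (nth 0 xs 0%nat) (nth 1 xs 0%nat)
    (nth 2 xs 0%nat) (nth 3 xs 0%nat)))
    as [e He] by (unfold leak; rec_tac).
  exists (CComp e [CProj 0; ep; ew; CProj 1]). intros s x y u c.
  apply ev_comp with [c; p s x y c; w s x y c; length s].
  - repeat (econstructor; eauto).
  - now apply (He [c; p s x y c; w s x y c; length s]). }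
assert (forall s x y c, lk s x y c = 0%nat -> 0 < pr y (F s x) /\
  forall a, lam y (F s x) = Finite a ->
    INR M * - ln (pr y (F s x)) - a <= qR (increment M c (w s x y c))
      <= INR M * - ln (pr y (F s x)) - a + (INR M + 1) * / 2 ^ length s) as Hsound.
{ intros s x y c h. apply leak_eq0 in h as [h1 h2].
  destruct hF as [hF _]. specialize (hF s x).
  assert (pr y (F s x) <= 1) as h1' by (destruct y; simpl; lra).
  destruct (log_leak_sound _ _ _ _ h1 h1' (Hp s x y c)) as [hpos hlog].
  split; [exact hpos|]. intros a E.
  assert (0 <= a) as ha by (pose proof (loss_ge0 lam y _ hl hF) as h; now rewrite E in h).
  pose proof (lam_leak_sound _ _ _ a h2 ha (Hw s x y c a E ha)) as hlam.
  unfold increment. rewrite qR_qsub, qR_qmul, qR_qnat.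
  pose proof (pos_INR M) as hM. destruct hlog as [hl1 hl2].
  apply Rmult_le_compat_l with (r := INR M) in hl1; [|exact hM].
  apply Rmult_le_compat_l with (r := INR M) in hl2; [|exact hM]. lra. }
(* The hypothesis is placed under the existential so that choice gives a total function; impossible
   labels get the dummy 0. *)
assert (forall s x y, exists c, 0 < pr y (F s x) ->
  lk s x y c = 0%nat /\ forall m, (m < c)%nat -> exists v, lk s x y m = S v) as Hleast.
{ intros s x y. destruct (Rlt_dec 0 (pr y (F s x))) as [hpos|hn]; [|exists 0%nat; contradiction].
  destruct (least_zero (lk s x y)) as [c Hc]; [|now exists c].
  destruct hF as [hF _]. specialize (hF s x).
  destruct (log_leak_complete (pr y (F s x)) (length s)) as (d & n1 & H1).
  { destruct y; simpl in *; lra. }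
  destruct (loss_finite lam y (F s x) hl hF hpos) as (a & E & ha).
  destruct (lam_leak_complete a (length s) ha) as (n2 & H2).
  exists (pairN (Nat.max n1 n2) d).
  assert (cert_prec (pairN (Nat.max n1 n2) d) = Nat.max n1 n2) as En by apply unfst_pairN.
  apply leak_eq0. split; [apply H1; [lia|]|apply H2; [rewrite En; lia|]].
  - pose proof (Hp s x y (pairN (Nat.max n1 n2) d)) as h. now rewrite En in h.
  - now apply Hw. }
destruct (rec2_increment M) as [ei Hei].
exists (CComp (CComp ei [CProj 0; ew]) [CMin elk; CProj 0; CProj 1]).
exists (fun s x y => let c := proj1_sig (constructive_indefinite_description _ (Hleast s x y)) in
  increment M c (w s x y c)).
intros s x y. split.
(* A halting run contains a result of the search, hence a verified certificate, and soundness gives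
   positivity. *)
- intros u v H. inversion H as [| | | |f gs xs ys v' Hys _| | |]; subst.
  inversion Hys as [|c' cs xs v' vs Hc _]; subst.
  inversion Hc as [| | | | | | |f xs n H0 _]; subst.
  now apply (Hsound s x y v'), (eval_det _ _ _ _ _ (Helk s x y u v')).
- intros hpos. destruct constructive_indefinite_description as [c Hc]; cbn [proj1_sig].
  specialize (Hc hpos) as [H0 Hlt]. split; [|now apply Hsound].
  intros u. apply ev_comp with [c; length s; encS (s ++ (x, y) :: u)].
  + constructor; [|repeat constructor; now apply eval_proj_eq].
    constructor; [rewrite <- H0; apply Helk|].
    intros m hm. destruct (Hlt m hm) as [v Hv]. exists v. rewrite <- Hv. apply Helk.
  + apply ev_comp with [c; w s x y c]; [|apply Hei].
    constructor; [now apply eval_proj_eq|]. constructor; [apply Hew|constructor].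
Qed.

(** * Sums along a data sequence *)

Fixpoint path_sum (h : list (Zt k) -> Obj k -> bool -> R) (past rest : list (Zt k)) : R :=
  match rest with
  | [] => 0
  | (x, y) :: r => h past x y + path_sum h (past ++ [(x, y)]) r
  end.

Fixpoint path_all (P : list (Zt k) -> Obj k -> bool -> Prop) (past rest : list (Zt k)) : Prop :=
  match rest with
  | [] => True
  | (x, y) :: r => P past x y /\ path_all P (past ++ [(x, y)]) r
  end.

Lemma path_sum_snoc h past s x y :
  path_sum h past (s ++ [(x, y)]) = path_sum h past s + h (past ++ s) x y.
Proof.
revert past. induction s as [|[x' y'] s IH]; intros past; simpl.
- rewrite app_nil_r. ring.
- rewrite IH, <- app_assoc. simpl. ring.
Qed.

Lemma path_all_snoc P past s x y :
  path_all P past (s ++ [(x, y)]) <-> path_all P past s /\ P (past ++ s) x y.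
Proof.
revert past. induction s as [|[x' y'] s IH]; intros past; simpl.
- rewrite app_nil_r. tauto.
- rewrite IH, <- app_assoc. simpl. tauto.
Qed.

(** The errors C 2^-t from the current step on form a geometric series with sum twice its first
    term, and the induction closes on this bound. *)
Lemma path_sum_le P h1 h2 C past s : 0 <= C ->
  (forall u x y, P u x y -> h1 u x y <= h2 u x y + C * / 2 ^ length u) ->
  path_all P past s -> path_sum h1 past s <= path_sum h2 past s + 2 * C * / 2 ^ length past.
Proof.
intros hC H. revert past. induction s as [|[x y] s IH]; intros past; simpl.
- intros _. pose proof (pow2_inv_gt0 (length past)). nra.
- intros [h1y hs]. apply IH in hs. rewrite length_app in hs. simpl in hs.
  specialize (H past x y h1y).
  replace (2 * C * / 2 ^ (length past + 1)) with (C * / 2 ^ length past) in hs; [lra|].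
  rewrite pow_add. field. apply pow_nonzero. lra.
Qed.

Lemma path_sum_linear a h1 b h2 past s :
  path_sum (fun u x y => a * h1 u x y + b * h2 u x y) past s
  = a * path_sum h1 past s + b * path_sum h2 past s.
Proof.
revert past. induction s as [|[x y] s IH]; intros past; simpl; [ring|]. rewrite IH. ring.
Qed.

Definition possible (F : list (Zt k) -> Obj k -> R) s x y : Prop := 0 < pr y (F s x).

Lemma loss_aux_possible lam F past s :
  (forall s x y, possible F s x y -> is_finite (lam y (F s x))) ->
  path_all (possible F) past s ->
  loss_aux lam F past s = Finite (path_sum (fun s x y => real (lam y (F s x))) past s).
Proof.
intros H. revert past. induction s as [|[x y] s IH]; intros past; simpl; [reflexivity|].
intros [hy hs]. rewrite IH by exact hs. now rewrite <- (H past x y hy).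
Qed.

Lemma log_loss_possible F s x y : possible F s x y -> is_finite (log_loss y (F s x)).
Proof. intros h. now rewrite log_loss_eq. Qed.

Lemma loss_aux_log F past s :
  path_all (possible F) past s \/ loss_aux log_loss F past s = p_infty.
Proof.
revert past. induction s as [|[x y] s IH]; intros past; [now left|]. simpl.
specialize (IH (past ++ [(x, y)])).
destruct (classic (possible F past x y)) as [hy|hn].
- destruct IH as [IH|IH]; [now left|right]. now rewrite IH, log_loss_eq.
- right. rewrite log_loss_infty by exact hn.
  destruct IH as [IH|IH]; [|now rewrite IH].
  now rewrite (loss_aux_possible _ _ _ _ (log_loss_possible F) IH).
Qed.

(** Primitive recursion evaluates every earlier step, so halting at the end certifies [P] along the
    whole path. *)
Lemma path_sum_code e (b : list (Zt k) -> Obj k -> bool -> nat) P :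
  (forall s x y, (forall u v, eval no_oracle e [length s; encS (s ++ (x, y) :: u)] v -> P s x y) /\
    (P s x y -> forall u, eval no_oracle e [length s; encS (s ++ (x, y) :: u)] (b s x y))) ->
  exists e', forall s,
    (forall v, eval no_oracle e' [encS s] v -> path_all P [] s) /\
    (path_all P [] s -> exists v, eval no_oracle e' [encS s] v /\
       qR v = path_sum (fun s x y => qR (b s x y)) [] s).
Proof.
intros H. destruct (rec_const 1 (qnat 0)) as [e0 H0]. destruct rec2_qadd as [ea Ha].
set (es := CPrec e0 (CComp ea [CProj 1; CComp e [CProj 0; CProj 2]])).
(* Here s is the part already processed; u is needed because every stage sees the code of the full
   sequence. *)
assert (forall s u,
  (forall v, eval no_oracle es [length s; encS (s ++ u)] v -> path_all P [] s) /\
  (path_all P [] s -> exists v, eval no_oracle es [length s; encS (s ++ u)] v /\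
     qR v = path_sum (fun s x y => qR (b s x y)) [] s)) as Hs.
{ intros s. induction s as [|[x y] s IH] using rev_ind; intros u.
  - split; [easy|]. intros _. exists (qnat 0). split; [|apply qR_qnat].
    constructor. now apply H0.
  - rewrite length_app, <- app_assoc, Nat.add_1_r, path_sum_snoc.
    cbn [app]. destruct (IH ((x, y) :: u)) as [IH1 IH2]. destruct (H s x y) as [He1 He2].
    split.
    + intros v Hv. inversion Hv as [| | | | | |f h n xs r v' Hr Hh|]; subst.
      apply path_all_snoc. split; [now apply (IH1 r)|].
      inversion Hh as [| | | |f gs xs ys v' Hys _| | |]; subst.
      inversion Hys as [|c cs xs v' vs _ Hvs]; subst.
      inversion Hvs as [|c cs xs v'' vs' Hc _]; subst.
      inversion Hc as [| | | |f gs xs ys v3 Hys' Hf| | |]; subst.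
      inversion Hys' as [|c cs xs w1 ws Hw1 Hws]; subst.
      inversion Hws as [|c cs xs w2 ws' Hw2 Hws']; subst.
      inversion Hws'; subst. inversion Hw1; subst. inversion Hw2; subst.
      exact (He1 u _ Hf).
    + intros hsy. apply path_all_snoc in hsy as [hs hy]. destruct (IH2 hs) as (r & Hr & Er).
      exists (qadd r (b s x y)). rewrite qR_qadd, Er. split; [|reflexivity].
      apply ev_precS with (1 := Hr). apply ev_comp with [r; b s x y]; [|apply Ha].
      constructor; [now apply eval_proj_eq|]. constructor; [|constructor].
      apply ev_comp with [length s; encS (s ++ (x, y) :: u)]; [|now apply He2].
      repeat constructor; now apply eval_proj_eq. }
exists (CComp es [length_code; CProj 0]). intros s. destruct (Hs s []) as [H1 H2].
rewrite app_nil_r in *. split.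
- intros v Hv. inversion Hv as [| | | |f gs xs ys v' Hys Hf| | |]; subst.
  inversion Hys as [|c cs xs w1 ws Hw1 Hws]; subst.
  inversion Hws as [|c cs xs w2 ws' Hw2 Hws']; subst.
  inversion Hws'; subst. inversion Hw2; subst.
  rewrite (eval_det _ _ _ _ _ Hw1 (eval_length_code s)) in Hf. exact (H1 _ Hf).
- intros hs. destruct (H2 hs) as (v & Hv & Ev). exists v. split; [|exact Ev].
  apply ev_comp with [length s; encS s]; [|exact Hv].
  constructor; [apply eval_length_code|]. repeat constructor; now apply eval_proj_eq.
Qed.

(** Off [P] the value is infinite, in agreement with a program for [B] that does not halt there: no
    upper bound is ever accepted. *)
Definition shifted_process (K : list (Zt k) -> Rbar) (P : list (Zt k) -> Prop)
    (B : list (Zt k) -> R) (M : nat) s : Rbar :=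
  if excluded_middle_informative (P s) then
    match K s with
    | Finite r => Finite ((r + B s) / INR M)
    | z => z
    end
  else p_infty.

Lemma upper_semicomputable_shifted K P B M e : (0 < M)%nat ->
  (forall s, K s <> m_infty) -> upper_semicomputable K ->
  (forall s, (forall v, eval no_oracle e [encS s] v -> P s) /\
     (P s -> exists v, eval no_oracle e [encS s] v /\ qR v = B s)) ->
  upper_semicomputable (shifted_process K P B M).
Proof.
intros hM hK [eK HK] H.
assert (rec2 (fun m v => qsub (qmul (qnat M) m) v)) as [et Ht] by rec_tac.
exists (CComp eK [CComp et [CProj 0; CComp e [CProj 1]]; CProj 1]). intros s m.
assert (0 < INR M) as hM' by now apply lt_0_INR.
assert (forall v, eval no_oracle e [encS s] v ->
  (Rbar_lt (K s) (Finite (qR (qsub (qmul (qnat M) m) v))) <->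
   Rbar_lt (shifted_process K P B M s) (Finite (qR m)))) as Hlt.
{ intros v Hv. destruct (H s) as [H1 H2]. specialize (H1 v Hv).
  destruct (H2 H1) as (v' & Hv' & E). rewrite <- (eval_det _ _ _ _ _ Hv Hv') in E.
  unfold shifted_process. destruct excluded_middle_informative; [|contradiction].
  rewrite qR_qsub, qR_qmul, qR_qnat, E.
  destruct (K s) as [r| |] eqn:EK; simpl; [|tauto|now destruct (hK s)].
  replace (qR m) with ((INR M * qR m) / INR M) at 2 by (field; lra).
  unfold Rdiv. split; intros h.
  - apply Rmult_lt_compat_r; [now apply Rinv_0_lt_compat|lra].
  - apply Rmult_lt_reg_r in h; [lra|now apply Rinv_0_lt_compat]. }
split.
(* Composition is strict: the run of [eK] is preceded by a halting run of [e], which yields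
   [P s]. *)
- intros [v Hv]. inversion Hv as [| | | |f gs xs ys v' Hys Hf| | |]; subst.
  inversion Hys as [|c cs xs w1 ws Hw1 Hws]; subst.
  inversion Hws as [|c cs xs w2 ws' Hw2 Hws']; subst.
  inversion Hws'; subst. inversion Hw2; subst. cbn [nth] in Hf.
  inversion Hw1 as [| | | |f gs xs ys v' Hys' Hf'| | |]; subst.
  inversion Hys' as [|c cs xs w3 ws Hw3 Hws1]; subst.
  inversion Hws1 as [|c cs xs w4 ws' Hw4 Hws2]; subst.
  inversion Hws2; subst. inversion Hw3; subst. cbn [nth] in Hf'.
  inversion Hw4 as [| | | |f gs xs ys v' Hys2 Hf2| | |]; subst.
  inversion Hys2 as [|c cs xs w5 ws Hw5 Hws3]; subst.
  inversion Hws3; subst. inversion Hw5; subst. cbn [nth] in Hf2.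
  apply (Hlt w4 Hf2), HK. rewrite (eval_det _ _ _ _ _ (Ht m w4) Hf'). now exists v.
- intros h. assert (P s) as hs.
  { revert h. unfold shifted_process. now destruct excluded_middle_informative. }
  destruct (H s) as [_ H2]. destruct (H2 hs) as (w & Hw & _).
  apply (Hlt w Hw), HK in h. destruct h as [v Hv]. exists v.
  apply ev_comp with [qsub (qmul (qnat M) m) w; encS s]; [|exact Hv].
  constructor; [|repeat constructor; now apply eval_proj_eq].
  apply ev_comp with [m; w]; [|apply Ht].
  constructor; [now apply eval_proj_eq|]. constructor; [|constructor].
  apply ev_comp with [encS s]; [|exact Hw]. repeat constructor; now apply eval_proj_eq.
Qed.

Lemma Rbar_le_p_infty z : Rbar_le z p_infty.
Proof. now destruct z. Qed.

(** The prediction offered by [K] is tilted into one for the log loss. The increment [b] pays M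
    times the log loss of F less its lam loss, which is what the tilting bound leaves open. *)
Lemma superloss_shifted lam F K (b : list (Zt k) -> Obj k -> bool -> R) M : (0 < M)%nat ->
  (forall p0 p, 0 <= p0 <= 1 -> 0 <= p <= 1 -> exists q, 0 <= q <= 1 /\
     forall y v a, 0 < pr y p0 -> lam y p0 = Finite v -> lam y p = Finite a ->
     0 < pr y q /\ - ln (pr y q) <= - ln (pr y p0) + (a - v) / INR M) ->
  loss_function lam -> (forall s x, 0 <= F s x <= 1) ->
  (forall s x y v, possible F s x y -> lam y (F s x) = Finite v ->
     INR M * - ln (pr y (F s x)) - v <= b s x y) ->
  superloss_process lam K ->
  superloss_process log_loss
    (shifted_process K (path_all (possible F) []) (path_sum b []) M).
Proof.
intros hM htilt hl hF hb [hKm hK].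
assert (0 < INR M) as hM' by now apply lt_0_INR.
split.
- intros s. unfold shifted_process. destruct excluded_middle_informative; [|easy].
  specialize (hKm s). now destruct (K s).
- intros s x. destruct (hK s x) as (p & hp & Hp).
  destruct (htilt (F s x) p (hF s x) hp) as (q & hq & Hq).
  exists q. split; [exact hq|]. intros y. specialize (Hp y). specialize (Hq y).
  unfold shifted_process at 2.
  destruct excluded_middle_informative as [hs'|_].
  2: { apply Rbar_le_p_infty. }
  pose proof hs' as hs2. apply path_all_snoc in hs2 as [hs hy]. cbn [app] in hy.
  destruct (K (s ++ [(x, y)])) as [r'| |] eqn:EK'.
  2: { apply Rbar_le_p_infty. }
  2: { now destruct (hKm (s ++ [(x, y)])). }
  destruct (loss_finite lam y (F s x) hl (hF s x) hy) as (v & Ev & _).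
  unfold shifted_process. destruct excluded_middle_informative as [_|]; [|contradiction].
  (* A finite [K] after the step forces [K s] and the loss of p to be finite. *)
  specialize (hKm s). destruct (K s) as [r| |] eqn:EK; [| |easy].
  2: { exfalso. destruct hl as [hl _]. specialize (hl y p). now destruct (lam y p). }
  destruct (lam y p) as [a| |] eqn:Ea; [| easy|].
  2: { destruct hl as [hl _]. now destruct (hl y p). }
  destruct (Hq v a hy Ev eq_refl) as [hpos Hln]. rewrite log_loss_eq by exact hpos.
  simpl in Hp |- *. rewrite path_sum_snoc. cbn [app].
  specialize (hb s x y v hy Ev).
  apply Rmult_le_reg_r with (INR M); [exact hM'|].
  apply Rmult_le_compat_r with (r := INR M) in Hln; [|lra].
  replace ((r + path_sum b [] s) / INR M + - ln (pr y q)) with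
    ((r + path_sum b [] s + - ln (pr y q) * INR M) / INR M) by (field; lra).
  replace ((- ln (pr y (F s x)) + (a - v) / INR M) * INR M) with
    (INR M * - ln (pr y (F s x)) + (a - v)) in Hln by (field; lra).
  unfold Rdiv. rewrite !Rmult_assoc, Rinv_l by lra. lra.
Qed.

(** The constant prediction 1/2 costs ln 2 <= 1 per step, so the length is a superloss process;
    being an integer, it is compared exactly with rationals. *)
Lemma log_complexity_finite K : predictive_complexity log_loss K ->
  forall s : list (Zt k), is_finite (K s).
Proof.
intros ((hm & _) & _ & hmin) s.
destruct (hmin (fun s => Finite (INR (length s)))) as [c Hc].
- split; [easy|]. intros s' x. exists (1 / 2). split; [lra|]. intros y.
  rewrite log_loss_eq by (destruct y; simpl; lra). simpl.
  replace (pr y (1 / 2)) with (/ 2) by (destruct y; simpl; lra).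
  rewrite length_app, plus_INR, ln_Rinv by lra. simpl.
  assert (ln 2 <= ln (exp 1)) as h by (apply ln_le; [lra|apply exp_ineq1_le]).
  rewrite ln_exp in h. lra.
- assert (rec2 (fun m l => 1 - qgt m (qnat l))%nat) as [e He] by rec_tac.
  (* The body ignores the search variable: the search stops at once when the test gives 0 and
     otherwise never. *)
  exists (CMin (CComp e [CProj 1; CComp length_code [CProj 2]])). intros s' m.
  assert (forall n, eval no_oracle (CComp e [CProj 1; CComp length_code [CProj 2]])
    [n; m; encS s'] (1 - qgt m (qnat (length s')))) as H.
  { intros n. apply ev_comp with [m; length s']; [|apply He].
    constructor; [now apply eval_proj_eq|]. constructor; [|constructor].
    apply ev_comp with [encS s']; [|apply eval_length_code].
    repeat constructor; now apply eval_proj_eq. }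
  assert ((1 - qgt m (qnat (length s')))%nat = 0%nat <-> INR (length s') < qR m) as E.
  { pose proof (qgt_eq0 m (qnat (length s'))) as h. rewrite qR_qnat in h.
    destruct (Rle_or_lt (qR m) (INR (length s'))) as [hle|hlt].
    - apply h in hle as hz. rewrite hz. split; [discriminate|lra].
    - split; [easy|]. intros _. assert (qgt m (qnat (length s')) <> 0%nat); [|lia].
      rewrite h. lra. }
  simpl Rbar_lt. rewrite <- E. split.
  + intros [v Hv]. inversion Hv as [| | | | | | |f xs n H0 _]; subst.
    exact (eval_det _ _ _ _ _ (H v) H0).
  + intros h. exists 0%nat. constructor; [|intros n hn; lia].
    specialize (H 0%nat). now rewrite h in H.
- specialize (Hc s). specialize (hm s). destruct (K s); [reflexivity|easy|easy].
Qed.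

End Processes.

Theorem theorem1 (k : nat) (lam : bool -> R -> Rbar)
  (Klam Klog : list (Zt k) -> Rbar)
  (F : list (Zt k) -> Obj k -> R) (zeta : nat -> Zt k) :
  CPM lam ->
  predictive_complexity lam Klam ->
  predictive_complexity log_loss Klog ->
  prediction_algorithm F ->
  random_wrt log_loss Klog F zeta ->
  random_wrt lam Klam F zeta.
Proof.
intros (hl & hcomp & hprop & hmix) (hKlam & hKusc & _) hKlog hF [C HC].
destruct (log_loss_tilting lam hl hprop hmix) as (M & hM & htilt).
assert (0 < INR M) as hM' by now apply lt_0_INR.
destruct (increment_code lam F M hl hcomp hF) as (e & b & Hb).
destruct (path_sum_code e b (possible F)) as [eB HB].
{ intros s x y. destruct (Hb s x y) as [h1 h2]. split; [exact h1|]. intros h. now apply h2. }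
set (B := path_sum (fun s x y => qR (b s x y)) []).
set (L := shifted_process Klam (path_all (possible F) []) B M).
assert (superloss_process log_loss L) as hL.
{ apply superloss_shifted with lam; trivial.
  - apply hF.
  - intros s x y v hy E. destruct (Hb s x y) as [_ h]. now apply h. }
assert (upper_semicomputable L) as hLusc.
{ apply upper_semicomputable_shifted with eB; trivial. apply hKlam. }
pose proof (log_complexity_finite Klog hKlog) as hfin.
destruct hKlog as (_ & _ & hmin). destruct (hmin L hL hLusc) as [c Hc].
(* It adds up M Loss_log <= M (Klog + C), M Klog <= Klam + B + M c and B <= M Loss_log - Loss_lam +
   2 (M + 1). *)
exists (INR M * (C + c) + 2 * (INR M + 1)). intros T. specialize (HC T).
set (s := prefix zeta T) in *. clearbody s.
assert (path_all (possible F) [] s) as hs.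
{ destruct (loss_aux_log F [] s) as [hs|hinf]; [exact hs|exfalso].
  unfold deficiency, Loss in HC. now rewrite hinf, <- (hfin s) in HC. }
assert (forall s x y, possible F s x y -> is_finite (lam y (F s x))) as hlam.
{ intros s' x y hy. destruct hF as [hF _].
  destruct (loss_finite lam y (F s' x) hl (hF s' x) hy) as (v & -> & _). reflexivity. }
unfold deficiency, Loss in *. specialize (Hc s).
rewrite (loss_aux_possible _ _ _ _ hlam hs).
rewrite (loss_aux_possible _ _ _ _ (log_loss_possible F) hs), <- (hfin s) in HC.
rewrite <- (hfin s) in Hc. unfold L, shifted_process in Hc.
destruct excluded_middle_informative as [_|]; [|contradiction].
destruct hKlam as [hKm _]. specialize (hKm s).
(* An infinite [Klam s] makes the deficiency minus infinity, since the lam loss of F is finite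
   here. *)
destruct (Klam s) as [r| |]; [|easy|easy].
pose proof (path_sum_le (possible F) (fun s x y => qR (b s x y))
  (fun s x y => INR M * real (log_loss y (F s x)) + -1 * real (lam y (F s x)))
  (INR M + 1) [] s) as hsum.
rewrite path_sum_linear in hsum. fold B in hsum. simpl in HC, Hc, hsum |- *.
set (Slog := path_sum (fun s x y => real (log_loss y (F s x))) [] s) in *.
set (Slam := path_sum (fun s x y => real (lam y (F s x))) [] s) in *.
assert (B s <= INR M * Slog + -1 * Slam + 2 * (INR M + 1) * / 1) as hBs.
{ apply hsum; [lra| |exact hs]. intros u x y hy. destruct (Hb u x y) as [_ h].
  destruct (h hy) as [_ h']. rewrite log_loss_eq by exact hy. cbn [real].
  specialize (h' (real (lam y (F u x))) (eq_sym (hlam u x y hy))). lra. }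
rewrite Rinv_1, Rmult_1_r in hBs.
assert (INR M * real (Klog s) <= r + B s + INR M * c) as h1.
{ apply Rmult_le_compat_l with (r := INR M) in Hc; [|lra].
  replace (INR M * ((r + B s) / INR M + c)) with (r + B s + INR M * c) in Hc by (field; lra).
  exact Hc. }
apply Rmult_le_compat_l with (r := INR M) in HC; [|lra]. lra.
Qed.
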